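(* Let $G=(V,E)$ be a graph with nonnegative edge weights, $n=|V|$, and let $\mathcal{M}_1=(V,\mathcal{I}_1)$ and $\mathcal{M}_2=(V,\mathcal{I}_2)$ be two arbitrary matroids on $V$ accessible through independence oracles. For every positive integer $p$, there is an algorithm computing $S\in\mathcal{I}_1\cap\mathcal{I}_2$ with $E_G(S)\ge \frac{2}{3}\left(1-\frac{1}{p+1}\right)\max_{X\in\mathcal{I}_1\cap\mathcal{I}_2}E_G(X)$, using $n^{O(p)}$ arithmetic operations and matroid oracle calls.
   Context: For $S\subseteq V$, $E_G(S)$ denotes the total weight of the edges of $G$ having at least one endpoint in $S$. An independence oracle for $\mathcal{M}_i$ answers, for a given $S\subseteq V$, whether $S\in\mathcal{I}_i$. *)

(* Defs.v *)
From HB Require Import structures.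
From mathcomp Require Import all_boot all_order all_algebra.

Set Implicit Arguments.
Unset Strict Implicit.
Unset Printing Implicit Defensive.

Import Order.TTheory GRing.Theory Num.Theory.
Local Open Scope ring_scope.

Record matroid (V : finType) := Matroid {
  indep : {set V} -> bool;
  indep0 : indep set0;
  indepS : forall A B : {set V}, A \subset B -> indep B -> indep A;
  indep_aug : forall A B : {set V}, indep A -> indep B -> (#|A| < #|B|)%N ->
    exists2 x, x \in B :\: A & indep (x |: A)
}.

(* Edges are two-element sets of vertices; the weight of a non-edge is
   irrelevant. *)
Record wgraph (R : realFieldType) (n : nat) := WGraph {
  edges : {set {set 'I_n}};
  weight : {set 'I_n} -> R;
  edges_card2 : forall e, e \in edges -> #|e| = 2;
  weight_ge0 : forall e, e \in edges -> 0 <= weight e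
}.

Definition edge_weight (R : realFieldType) (n : nat) (G : wgraph R n)
    (S : {set 'I_n}) : R :=
  \sum_(e in edges G | e :&: S != set0) weight G e.

(* The base point of the iterated maximum is itself one of the candidates,
   since the empty set is independent in both matroids. *)
Definition max_common_weight (R : realFieldType) (n : nat) (G : wgraph R n)
    (M1 M2 : matroid 'I_n) : R :=
  \big[Num.max/edge_weight G set0]_(X : {set 'I_n} | indep M1 X && indep M2 X)
    edge_weight G X.

(* Algorithms are the programs of a real random access machine with two
   set-membership oracles.  The memory consists of natural number cells (used
   for indices, flags and sets) and of cells holding elements of the ordered
   field R.  The cell "a, i, j" is the entry (i, j) of the array number a: the
   array a is fixed by the program text, the indices i and j are computed.
   Natural numbers have only addition and truncated subtraction, so that in t
   steps they cannot exceed t + O(1) bits; R has the four field operations and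
   comparison.  Programs do not mention R or the instance. *)
Inductive nexp :=
| NConst of nat
| NGet of nat & nexp & nexp
| NAdd of nexp & nexp
| NSub of nexp & nexp.

Inductive rexp :=
| RNat of nexp
| RGet of nat & nexp & nexp
| RAdd of rexp & rexp
| RSub of rexp & rexp
| RMul of rexp & rexp
| RDiv of rexp & rexp.

Inductive test :=
| TNatLe of nexp & nexp
| TRealLe of rexp & rexp
| TNot of test
| TAnd of test & test.

(* CAsk k a i d x y asks the oracle k about the set stored as a 0/nonzero
   indicator vector in row i of the array a, and writes the answer into the
   cell d, x, y. *)
Inductive com :=
| CSkip
| CSetN of nat & nexp & nexp & nexp
| CSetR of nat & nexp & nexp & rexp
| CAsk of bool & nat & nexp & nat & nexp & nexp
| CSeq of com & com
| CIf of test & com & com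
| CWhile of test & com.

Record state (R : realFieldType) := State {
  nmem : nat -> nat -> nat -> nat;
  rmem : nat -> nat -> nat -> R
}.

Definition upd (T : Type) (m : nat -> nat -> nat -> T) (a i j : nat) (v : T) :=
  fun a' i' j' : nat =>
    if [&& a' == a, i' == i & j' == j] then v else m a' i' j'.

Section Semantics.

Variables (R : realFieldType) (n : nat) (oracle : bool -> {set 'I_n} -> bool).
Implicit Types (s : state R) (e : nexp) (r : rexp) (b : test).

Fixpoint nval s e : nat :=
  match e with
  | NConst k => k
  | NGet a e1 e2 => nmem s a (nval s e1) (nval s e2)
  | NAdd e1 e2 => (nval s e1 + nval s e2)%N
  | NSub e1 e2 => (nval s e1 - nval s e2)%N
  end.

Fixpoint rval s r : R :=
  match r with
  | RNat e => (nval s e)%:R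
  | RGet a e1 e2 => rmem s a (nval s e1) (nval s e2)
  | RAdd r1 r2 => rval s r1 + rval s r2
  | RSub r1 r2 => rval s r1 - rval s r2
  | RMul r1 r2 => rval s r1 * rval s r2
  | RDiv r1 r2 => rval s r1 / rval s r2
  end.

Fixpoint tval s b : bool :=
  match b with
  | TNatLe e1 e2 => (nval s e1 <= nval s e2)%N
  | TRealLe r1 r2 => rval s r1 <= rval s r2
  | TNot b1 => ~~ tval s b1
  | TAnd b1 b2 => tval s b1 && tval s b2
  end.

Fixpoint ncost e : nat :=
  match e with
  | NConst _ => 1
  | NGet _ e1 e2 | NAdd e1 e2 | NSub e1 e2 => (ncost e1 + ncost e2).+1
  end.

Fixpoint rcost r : nat :=
  match r with
  | RNat e => (ncost e).+1
  | RGet _ e1 e2 => (ncost e1 + ncost e2).+1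
  | RAdd r1 r2 | RSub r1 r2 | RMul r1 r2 | RDiv r1 r2 =>
      (rcost r1 + rcost r2).+1
  end.

Fixpoint tcost b : nat :=
  match b with
  | TNatLe e1 e2 => (ncost e1 + ncost e2).+1
  | TRealLe r1 r2 => (rcost r1 + rcost r2).+1
  | TNot b1 => (tcost b1).+1
  | TAnd b1 b2 => (tcost b1 + tcost b2).+1
  end.

Definition row_set s (a i : nat) : {set 'I_n} :=
  [set j : 'I_n | nmem s a i j != 0%N].

Definition set_nmem s (a i j v : nat) : state R :=
  State (upd (nmem s) a i j v) (rmem s).

Definition set_rmem s (a i j : nat) (v : R) : state R :=
  State (nmem s) (upd (rmem s) a i j v).

(* exec c s t s': started in s, the program c halts in s' after t elementary
   steps; every arithmetic operation, comparison, memory access, control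
   decision and oracle call is counted. *)
Inductive exec : com -> state R -> nat -> state R -> Prop :=
| ExecSkip s : exec CSkip s 1 s
| ExecSetN a e1 e2 e s :
    exec (CSetN a e1 e2 e) s (ncost e1 + ncost e2 + ncost e).+1
      (set_nmem s a (nval s e1) (nval s e2) (nval s e))
| ExecSetR a e1 e2 r s :
    exec (CSetR a e1 e2 r) s (ncost e1 + ncost e2 + rcost r).+1
      (set_rmem s a (nval s e1) (nval s e2) (rval s r))
| ExecAsk k a e d e1 e2 s :
    exec (CAsk k a e d e1 e2) s (ncost e + ncost e1 + ncost e2).+1
      (set_nmem s d (nval s e1) (nval s e2)
        (nat_of_bool (oracle k (row_set s a (nval s e)))))
| ExecSeq c1 c2 s t1 s1 t2 s2 :
    exec c1 s t1 s1 -> exec c2 s1 t2 s2 ->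
    exec (CSeq c1 c2) s (t1 + t2) s2
| ExecIf b c1 c2 s t s' :
    exec (if tval s b then c1 else c2) s t s' ->
    exec (CIf b c1 c2) s (tcost b + t).+1 s'
| ExecWhileF b c s :
    ~~ tval s b -> exec (CWhile b c) s (tcost b).+1 s
| ExecWhileT b c s t1 s1 t2 s2 :
    tval s b -> exec c s t1 s1 -> exec (CWhile b c) s1 t2 s2 ->
    exec (CWhile b c) s (tcost b + t1 + t2).+1 s2.

End Semantics.

Definition matroid_oracle (n : nat) (M1 M2 : matroid 'I_n) (k : bool) :
    {set 'I_n} -> bool :=
  if k then indep M2 else indep M1.

(* Entry (i, j) of the symmetric weight matrix of G, with value 0 outside the
   edges (in particular on the diagonal) and outside the range of indices. *)
Definition weight_entry (R : realFieldType) (n : nat) (G : wgraph R n)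
    (i j : nat) : R :=
  match insub i, insub j with
  | Some u, Some v =>
      if [set u; v] \in edges G then weight G [set u; v] else 0
  | _, _ => 0
  end.

(* Initially n is in cell (0, 0) of the natural number array 0, the weight
   matrix is the array 0 over R, and every other cell is 0. *)
Definition init_state (R : realFieldType) (n : nat) (G : wgraph R n) :
    state R :=
  State (upd (fun _ _ _ => 0%N) 0%N 0%N 0%N n)
        (fun a i j => if a == 0%N then weight_entry G i j else 0).

Definition output (R : realFieldType) (n : nat) (s : state R) : {set 'I_n} :=
  row_set n s 1 0.

(* Main.v *)
Require Import Defs.
From mathcomp Require Import all_boot all_order all_algebra all_fingroup.
From mathcomp Require Import zify ring lra.
Import Order.TTheory GRing.Theory Num.Theory.
Local Open Scope ring_scope.
Set Implicit Arguments.
Unset Strict Implicit.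
Unset Printing Implicit Defensive.

(* Local search with the potential Phi that values an edge at its weight if one
   endpoint is chosen and at 3/2 times its weight if both are.  In the exchange
   graphs of the two matroids, a solution S and a competitor O are joined by
   alternating cycles.  A closed walk of chords lets such a cycle be split
   fractionally into shorter ones; once there is none, the cycle can be cut into
   exchanges that keep S independent, insert at most P and delete at most P + 1
   elements.  In total each element of O \ S is inserted with multiplicity P and
   each element of S \ O is deleted with multiplicity at most P + 1.  Summing the
   gains of Phi edge by edge yields
     P E(O) <= (3/2) (P + 1) E(S) + P n g,
   where g is the best gain of one exchange.  The gains of all rounds add up to at
   most (3/2) max E, so for P = 2p polynomially many rounds suffice, and the best
   set seen has the required value.  In the scores below, Phi is scaled by 2 and
   edges are counted as ordered pairs. *)

(** * Exchanges between common independent sets *)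

Section MatroidExchange.
Local Open Scope nat_scope.

(** The obstacle is that exchanging a segment of an alternating cycle need not preserve independence
    when the cycle has chords. Chords that admit an acyclic order are harmless, since the exchanges
    can then be made one by one without disturbing the later ones. A single chord does not decompose
    the cycle: it closes a shorter cycle on one side only, and the elements of the other side are
    lost. A closed walk of chords repairs this on average, because its shorter cycles meet all
    elements equally often; this is why covers carry multiplicities. The two matroids may need
    different orders, which does no harm, as independence is checked for each of them separately.
    The weights lie in an arbitrary ordered field, which gives no polynomial bound on the number of
    strict improvements before a local optimum. Hence no local optimum is awaited: the inequality
    with the error term is used in every round, and the errors telescope. *)

Lemma indep_extend (V : finType) (M : matroid V) (A B : {set V}) :
  indep M A -> indep M B -> #|A| <= #|B| ->
  exists Y : {set V}, [/\ A \subset Y, Y \subset A :|: B, indep M Y & #|Y| = #|B|].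
Proof.
move=> iA iB; move: {2}(#|B| - #|A|) (erefl (#|B| - #|A|)) => d.
elim: d A iA => [|d IH] A iA dE leAB.
  by exists A; split => //; [apply: subsetUl | apply/eqP; rewrite eqn_leq leAB -subn_eq0 dE].
have ltAB : #|A| < #|B| by rewrite -subn_gt0 dE.
have [x /setDP[xB xA] ixA] := indep_aug iA iB ltAB.
have cxA : #|x |: A| = #|A|.+1 by rewrite cardsU1 xA.
have [||Y [sY sYU iY cY]] := IH _ ixA.
- by rewrite cxA subnS dE.
- by rewrite cxA.
exists Y; split => //; first exact: subset_trans (subsetUr _ _) sY.
apply: subset_trans sYU _; apply/subsetP => y; rewrite !inE => /orP[/orP[/eqP->|->//]|->].
  by rewrite xB orbT.
by rewrite orbT.
Qed.

(** If [i |: J] is dependent, then [X] together with [i] is its circuit. Were no element of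
    [X :\: I] addable to [I :\ i], then [I :\ i] would span [X], and hence [i], although [I] is
    independent. *)
Lemma symmetric_exchange (V : finType) (M : matroid V) (I J : {set V}) i :
  indep M I -> indep M J -> #|I| = #|J| -> i \in I :\: J ->
  exists2 j, j \in J :\: I & indep M (j |: I :\ i) /\ indep M (i |: J :\ j).
Proof.
move=> iI iJ cIJ /setDP[iiI niJ].
have iIi : indep M (I :\ i) by apply: indepS iI; apply: subsetDl.
have cIi : #|I| = #|I :\ i|.+1 by rewrite (cardsD1 i) iiI.
have [iJi|diJ] := boolP (indep M (i |: J)).
  have [|j] := indep_aug iIi iJ; first by rewrite -cIJ cIi.
  rewrite !inE negb_and negbK => /andP[ji jJ] ij.
  have nji : j != i by apply: contraNneq niJ => <-.
  exists j; first by rewrite inE jJ; case/orP: ji nji => [->//|->].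
  split => //; apply: indepS iJi; apply: setUS; apply: subsetDl.
pose X := [set j in J | indep M (i |: J :\ j)].
have XJ : X \subset J by apply/subsetP => x; rewrite inE => /andP[].
have iX : indep M X by apply: indepS iJ.
have dXi : ~~ indep M (i |: X).
  apply/negP => iXi.
  have niX : i \notin X by rewrite inE (negbTE niJ).
  have [leXJ|ltJX] := leqP #|i |: X| #|J|; last first.
    move: ltJX; rewrite cardsU1 niX add1n ltnS => leJX.
    have XE : X = J by apply/eqP; rewrite eqEcard XJ.
    by rewrite -XE iXi in diJ.
  have [Y [sXY sYU iY cY]] := indep_extend iXi iJ leXJ.
  have sYJ : Y \subset i |: J.
    apply: subset_trans sYU _; rewrite subUset subsetUr andbT.
    exact: setUS.
  have iYi : i \in Y by apply: (subsetP sXY); rewrite !inE eqxx.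
  have [j jJ jY] : exists2 j, j \in J & j \notin Y.
    apply/subsetPn; apply: contraNN diJ => sJY.
    have -> : i |: J = Y.
      apply/eqP; rewrite eqEsubset sYJ andbT subUset sJY andbT sub1set //.
    exact: iY.
  have YE : Y = i |: J :\ j.
    apply/eqP; rewrite eqEcard cY cardsU1 !inE (negbTE niJ) andbF /=.
    rewrite (cardsD1 j J) jJ leqnn andbT; apply/subsetP => y yY.
    move: (subsetP sYJ _ yY); rewrite !inE; case: eqP => //= _ ->.
    by rewrite andbT; apply: contraNneq jY => <-.
  have jX : j \in X by rewrite inE jJ -YE.
  by case/negP: jY; apply: (subsetP sXY); rewrite in_setU jX orbT.
have [/existsP[j /andP[jX /andP[jnI ij]]]|noj] :=
  boolP [exists j, [&& j \in X, j \notin I & indep M (j |: I :\ i)]].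
  exists j; first by rewrite inE jnI (subsetP XJ).
  by split => //; move: jX; rewrite inE => /andP[].
(* The statement that [I :\ i] spans [X], in terms of cardinalities. *)
have maxI Z : indep M Z -> Z \subset X :|: (I :\ i) -> #|Z| <= #|I :\ i|.
  move=> iZ sZ; rewrite leqNgt; apply/negP => ltZ.
  have [z /setDP[zZ zI] iz] := indep_aug iIi iZ ltZ.
  have zX : z \in X by move: (subsetP sZ _ zZ); rewrite inE (negbTE zI) orbF.
  case/negP: noj; apply/existsP; exists z; rewrite zX iz andbT /=.
  apply: contra zI => zI; rewrite !inE zI andbT.
  by apply: contraNneq niJ => <-; apply: (subsetP XJ).
have leX : #|X| <= #|I :\ i| by apply: maxI => //; apply: subsetUl.
have [Y [sXY sYU iY cY]] := indep_extend iX iIi leX.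
have [|x /setDP[xI xY] ix] := indep_aug iY iI; first by rewrite cY cIi.
have [xi|nxi] := eqVneq x i.
  case/negP: dXi; apply: indepS ix; rewrite xi; exact: setUS.
have : #|x |: Y| <= #|I :\ i|.
  apply: maxI => //; rewrite subUset sYU andbT sub1set !inE nxi xI orbT //.
by rewrite cardsU1 xY cY add1n ltnn.
Qed.

(** Symmetric exchange takes the place of Hall's theorem: once [i] is matched with [j], the
    induction passes to [i |: J :\ j] and keeps [I] fixed, so that all exchanges found refer to the
    same [I]. *)
Lemma exchange_matching (V : finType) (M : matroid V) (I J : {set V}) :
  indep M I -> indep M J -> #|I| = #|J| ->
  exists h : V -> V, {in J :\: I &, injective h} /\
    forall j, j \in J :\: I -> h j \in I :\: J /\ indep M (j |: I :\ h j).
Proof.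
move=> iI iJ cIJ.
move: {2}#|I :\: J| (leqnn #|I :\: J|) => d.
elim: d J iJ cIJ => [|d IH] J iJ cIJ; last first.
  have [I0|/set0Pn[i iIJ]] := eqVneq (I :\: J) set0; first by move=> _; apply: IH; rewrite // I0 cards0.
  move=> led.
  have [j jJI [ij iij]] := symmetric_exchange iI iJ cIJ iIJ.
  have [iiI niJ] := setDP iIJ; have [jJ njI] := setDP jJI.
  have [||h [hinj hP]] := IH _ iij.
  - by rewrite cardsU1 !inE (negbTE niJ) andbF cIJ (cardsD1 j J) jJ.
  - have /subset_leq_card/leq_trans : I :\: (i |: J :\ j) \subset (I :\: J) :\ i.
      apply/subsetP => x; rewrite !inE !negb_or negb_and negbK.
      case: (x =P i) => //= _ /andP[/orP[/eqP->|->]] //; by rewrite (negbTE njI).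
    by apply; move: led; rewrite (cardsD1 i (I :\: J)) iIJ.
  have DE x : x \in J :\: I -> x != j -> x \in (i |: J :\ j) :\: I.
    by rewrite !inE => /andP[-> ->] ->; rewrite orbT.
  exists (fun x => if x == j then i else h x); split.
    move=> x y xD yD /=; case: (x =P j) => [->|/eqP xj]; case: (y =P j) => [->//|/eqP yj].
    - move=> hy; have [] := hP _ (DE _ yD yj); rewrite -hy !inE eqxx //.
    - move=> hx; have [] := hP _ (DE _ xD xj); rewrite hx !inE eqxx //.
    - by apply: hinj; apply: DE.
  move=> x xD; case: (x =P j) => [->//|/eqP xj].
  have [hxI ihx] := hP _ (DE _ xD xj); split => //.
  have hxI' : h x \in I by move: hxI; rewrite inE => /andP[].
  have hxj : h x != j by apply: contraNneq njI => <-.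
  by move: hxI; rewrite !inE hxj hxI' negb_or => /andP[/andP[_ ->]].
rewrite leqn0 cards_eq0 => /eqP I0.
exists id; split => // j; suff -> : J :\: I = set0 by rewrite inE.
apply/eqP; rewrite -cards_eq0 cardsD setIC.
have := cardsD I J; rewrite I0 cards0; lia.
Qed.

(* The exchange relation to the remaining elements is not affected by an
   exchange of the first pair, because [b] already depends on [I :\ i]. *)
Lemma exchange_after (V : finType) (M : matroid V) (I : {set V}) i j b k :
  indep M I -> i \in I -> j \notin I -> b \notin I -> b != j ->
  k \in I -> k != i -> indep M (j |: I :\ i) -> ~~ indep M (b |: I :\ i) ->
  indep M (b |: (j |: I :\ i) :\ k) = indep M (b |: I :\ k).
Proof.
move=> iI iiI njI nbI nbj kI nki ij dbi.
have cIi : #|I| = #|I :\ i|.+1 by rewrite (cardsD1 i) iiI.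
have cIik : #|I :\ i| = #|I :\ i :\ k|.+1 by rewrite (cardsD1 k (I :\ i)) !inE nki kI.
have nkj : k != j by apply: contraNneq njI => <-.
pose Z := b |: I :\ i :\ k.
have cZ : #|Z| = #|I :\ i| by rewrite cardsU1 !inE (negbTE nbI) !andbF cIik.
have kZ : k |: Z = b |: I :\ i.
  apply/setP => x; rewrite !inE; case: (x =P k) => [->|_] //=; rewrite ?nki ?kI ?orbT //.
apply/idP/idP => ib.
  have iZ : indep M Z.
    apply: indepS ib; apply/subsetP => x; rewrite !inE.
    by case: (x == b) => //= /and3P[-> -> ->]; rewrite orbT.
  have [|x] := indep_aug iZ iI; first by rewrite cZ cIi.
  rewrite inE => /andP[nxZ xI] ix.
  have xik : (x == i) || (x == k).
    move: nxZ; rewrite !inE xI andbT; case: (x == i); case: (x == k); rewrite //= orbT //.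
  case/orP: xik => /eqP xE; last by rewrite -kZ -xE ix in dbi.
  apply: indepS ix; apply/subsetP => y; rewrite xE !inE.
  by case: (y == i) => //=; case: (y == b).
have iZ : indep M Z.
  by apply: indepS ib; apply/subsetP => x; rewrite !inE; case: (x == b) => //= /and3P[-> _ ->].
have [|x] := indep_aug iZ ij.
  by rewrite cZ cardsU1 !inE (negbTE njI) andbF.
rewrite inE => /andP[nxZ xI] ix.
have xjk : (x == j) || (x == k).
  by move: nxZ xI; rewrite !inE; case: (x == k); case: (x == b);
    case: (x == j); case: (x == i); case: (x \in I).
case/orP: xjk => /eqP xE; last by rewrite -kZ -xE ix in dbi.
apply: indepS ix; apply/subsetP => y; rewrite xE !inE.
by case: (y == j) => //=; case: (y == b) => //=; rewrite ?andbF //= andbCA.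
Qed.

(** The exchanges are made in the order of [s]. The triangular shape lets [exchange_after] carry the
    hypotheses on the later pairs over to the set obtained from the first exchange. *)
Lemma triangular_indep (V : finType) (T : eqType) (M : matroid V)
    (phi nu : T -> V) (s : seq T) (I : {set V}) :
  indep M I -> uniq (map phi s) -> uniq (map nu s) ->
  {in s, forall a, [/\ phi a \notin I, nu a \in I & indep M (phi a |: I :\ nu a)]} ->
  pairwise (fun a b => ~~ indep M (phi b |: I :\ nu a)) s ->
  indep M ([set x in map phi s] :|: (I :\: [set x in map nu s])).
Proof.
elim: s I => [|a s IH] I iI; first by move=> _ _ _ _; apply: indepS iI; apply/subsetP => x; rewrite !inE.
rewrite /= => /andP[ua us] /andP[na ns] sP /andP[/allP pa ps].
have [njI iiI ij] := sP a (mem_head _ _).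
have sP' b : b \in s -> [/\ phi b \notin I, nu b \in I & indep M (phi b |: I :\ nu b)].
  by move=> bs; apply: sP; rewrite inE bs orbT.
have nphi b : b \in s -> phi b != phi a by move=> bs; apply: contraNneq ua => <-; apply: map_f.
have nnu b : b \in s -> nu b != nu a by move=> bs; apply: contraNneq na => <-; apply: map_f.
have exE b c : b \in s -> c \in s ->
    indep M (phi b |: (phi a |: I :\ nu a) :\ nu c) = indep M (phi b |: I :\ nu c).
  move=> bs cs; have [? ? ?] := sP' b bs; have [? ? ?] := sP' c cs.
  by apply: exchange_after; rewrite ?nphi ?nnu ?pa.
suff : indep M ([set x in map phi s] :|: ((phi a |: I :\ nu a) :\: [set x in map nu s])).
  apply: indepS; apply/subsetP => x; rewrite !inE negb_or.
  case: (x =P phi a) => [->|_] /=; rewrite ?andbT; last first.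
    by case: (x \in map phi s) => //= /andP[/andP[-> ->] ->].
  move=> _; have : phi a \notin map nu s; last by move->; rewrite orbT.
  by apply: contra njI => /mapP[b bs ->]; have [] := sP' b bs.
apply: IH => //.
  move=> b bs; have [nbI nbI' ib] := sP' b bs; split; last by rewrite exE.
    by rewrite !inE negb_or nphi // (negbTE nbI) andbF.
  by rewrite !inE nnu // nbI' orbT.
apply/(pairwiseP a) => x y xs ys xy; rewrite exE ?mem_nth //.
exact: (pairwiseP a ps x y xs ys xy).
Qed.

(** Topological sorting: an element without an [r]-arc to another element of [A] goes to the front.
    If every element has such an arc, iterating a choice [f] of successors becomes periodic. *)
Lemma sorted_or_walk (V : finType) (r : rel V) (A : {set V}) :
  (exists s, [/\ uniq s, s =i A & pairwise (fun a b => ~~ r a b) s]) \/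
  (exists k f y, [/\ 0 < k, iter k f y = y &
     forall l, let a := iter l f y in [/\ a \in A, f a \in A, f a != a & r a (f a)]]).
Proof.
move: {2}#|A| (leqnn #|A|) => d; elim: d A => [|d IH] A.
  rewrite leqn0 cards_eq0 => /eqP->; left; exists [::]; split => // x.
  by rewrite inE.
move=> led.
have [/existsP[x /andP[xA /forallP/= xP]]|nox] :=
    boolP [exists x, (x \in A) && [forall b, (b \in A) && (b != x) ==> ~~ r x b]].
  have [|[s [us sA ps]]|[k [f [y [k0 ky fP]]]]] := IH (A :\ x).
  - by move: led; rewrite (cardsD1 x) xA.
  - left; exists (x :: s); split.
    + by rewrite /= us andbT sA !inE eqxx.
    + by move=> z; rewrite inE sA !inE; case: eqP => // ->.
    + rewrite /= ps andbT; apply/allP => b; rewrite sA !inE => /andP[bx bA].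
      by have := xP b; rewrite bx bA.
  - right; exists k, f, y; split => // l /=.
    by have [] := fP l; rewrite !inE => /andP[_ ->] /andP[_ ->].
have [A0|/set0Pn[x0 x0A]] := eqVneq A set0.
  by left; exists [::]; split => // x; rewrite A0 inE.
right.
pose f x := odflt x [pick b | [&& b \in A, b != x & r x b]].
have fP x : x \in A -> [/\ f x \in A, f x != x & r x (f x)].
  move=> xA; rewrite /f; case: pickP => [b /and3P[]|nob] //=.
  case/negP: nox; apply/existsP; exists x; rewrite xA; apply/forallP => b.
  by apply/implyP => /andP[bA bx]; apply/negP => rxb; have := nob b; rewrite bA bx rxb.
have iterA l : iter l f x0 \in A by elim: l => //= l /fP[].
have /trajectP[m ltm mE] := looping_order f x0.
(* The iteration may have a tail, so the closed walk starts at step [m], the first visit of the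
   point that recurs. *)
exists (fingraph.order f x0 - m), f, (iter m f x0); split.
- by rewrite subn_gt0.
- by rewrite -iterD subnK // ltnW.
- by move=> l /=; rewrite -iterD; have [] := fP _ (iterA (l + m)); split.
Qed.

(** * Fractional covers by short exchanges *)

Definition short_exchange (V : finType) (M1 M2 : matroid V) (I : {set V}) (p : nat)
    (t : {set V} * {set V}) : bool :=
  [&& indep M1 (t.1 :|: (I :\: t.2)), indep M2 (t.1 :|: (I :\: t.2)),
      t.1 != set0, #|t.1| <= p & #|t.2| <= p.+1].

(* The factor Q clears the denominators of a fractional cover. *)
Definition exchange_cover (V : finType) (M1 M2 : matroid V) (I : {set V}) (p : nat)
    (alpha beta : V -> nat) : Prop :=
  exists Q (F : seq ({set V} * {set V})),
    [/\ 0 < Q, all (short_exchange M1 M2 I p) F,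
        forall j, \sum_(t <- F) (j \in t.1) = Q * p * alpha j
      & forall i, \sum_(t <- F) (i \in t.2) <= Q * p.+1 * beta i].

(* The alternating cycles j -> N j -> g j -> N (g j) -> ... of the exchange graph
   of I, where A is a set of elements j closed under g. *)
Definition exchange_cycles (V : finType) (M1 M2 : matroid V) (I : {set V})
    (g : {perm V}) (N : V -> V) (A : {set V}) : Prop :=
  {in A &, injective N} /\
  forall j, j \in A -> [/\ j \notin I, g j \in A, N j \in I,
    indep M1 (j |: I :\ N j) & indep M2 (g j |: I :\ N j)].

Lemma exchange_cover_sym (V : finType) (M1 M2 : matroid V) I p alpha beta :
  exchange_cover M1 M2 I p alpha beta -> exchange_cover M2 M1 I p alpha beta.
Proof.
case=> Q [F [Q0 vF cF rF]]; exists Q, F; split => //.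
by apply: sub_all vF => t; rewrite /short_exchange => /and5P[-> -> -> -> ->].
Qed.

(** Multiplicities are divided by [w] by moving [w] into the denominator [Q]. With [w = 1] this
    replaces [alpha] and [beta] by pointwise equal functions. *)
Lemma exchange_cover_scale (V : finType) (M1 M2 : matroid V) I p w alpha beta
    (alpha' beta' : V -> nat) :
  0 < w -> exchange_cover M1 M2 I p alpha' beta' ->
  (forall j, alpha' j = w * alpha j) -> (forall j, beta' j = w * beta j) ->
  exchange_cover M1 M2 I p alpha beta.
Proof.
move=> w0 [Q [F [Q0 vF cF rF]]] aE bE; exists (Q * w), F; split => //.
- by rewrite muln_gt0 Q0.
- by move=> j; rewrite cF aE; nia.
- by move=> j; apply: leq_trans (rF j) _; rewrite bE; nia.
Qed.

Lemma sum_flatten_nseq (T : Type) (q : nat) (F : seq T) (f : T -> nat) :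
  \sum_(t <- flatten (nseq q F)) f t = q * \sum_(t <- F) f t.
Proof. by rewrite big_flatten /= big_nseq iter_addn_0 mulnC. Qed.

Lemma exchange_cover_add (V : finType) (M1 M2 : matroid V) I p
    (a1 b1 a2 b2 : V -> nat) :
  exchange_cover M1 M2 I p a1 b1 -> exchange_cover M1 M2 I p a2 b2 ->
  exchange_cover M1 M2 I p (fun j => a1 j + a2 j) (fun j => b1 j + b2 j).
Proof.
move=> [Q1 [F1 [Q10 vF1 cF1 rF1]]] [Q2 [F2 [Q20 vF2 cF2 rF2]]].
exists (Q1 * Q2), (flatten (nseq Q2 F1) ++ flatten (nseq Q1 F2)); split.
- by rewrite muln_gt0 Q10.
- by apply/allP => t; rewrite mem_cat => /orP[] /flattenP[s /nseqP[-> _]]; apply/allP: t.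
- by move=> j; rewrite big_cat /= !sum_flatten_nseq cF1 cF2; nia.
- move=> i; rewrite big_cat /= !sum_flatten_nseq mulnDr leq_add //.
    by rewrite [Q1 * Q2]mulnC -!mulnA leq_mul2l !mulnA rF1 orbT.
  by rewrite -!mulnA leq_mul2l !mulnA rF2 orbT.
Qed.

Lemma exchange_cover0 (V : finType) (M1 M2 : matroid V) I p :
  exchange_cover M1 M2 I p (fun=> 0) (fun=> 0).
Proof. by exists 1, [::]; split => // i; rewrite big_nil ?muln0. Qed.

Lemma exchange_cover_sum (V : finType) (M1 M2 : matroid V) I p
    (k : nat) (a b : nat -> V -> nat) :
  (forall l, exchange_cover M1 M2 I p (a l) (b l)) ->
  exchange_cover M1 M2 I p (fun j => \sum_(l < k) a l j) (fun j => \sum_(l < k) b l j).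
Proof.
move=> H; elim: k => [|k IH].
  by apply: (exchange_cover_scale (w := 1) _ (exchange_cover0 M1 M2 I p)) => // j;
    rewrite big_ord0.
by apply: (exchange_cover_scale (w := 1) _ (exchange_cover_add IH (H k))) => // j;
  rewrite big_ord_recr mul1n.
Qed.

(** * Splitting an alternating cycle along chords *)

Lemma tperm_notin_porbit (V : finType) (g : {perm V}) a b :
  a != b -> a \in porbit g b -> b \notin porbit (tperm a b * g)%g a.
Proof.
(* The transposition adds one orbit to those of [g]. Applied a second time it restores [g] and so
   removes one, which happens only if it joins two different orbits. *)
move=> nab aOb; have /= := porbits_mul_tperm g a b.
have /= := porbits_mul_tperm (tperm a b * g)%g a b.
rewrite mulgA tperm2 mul1g aOb nab [b \in _]porbit_sym /=.
by case: (a \in _) => //=; lia.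
Qed.

(* The last clause says that, following g, the shorter cycle is entered after b
   and left after a. *)
Lemma chord_cycle (V : finType) (M1 M2 : matroid V) I (g : {perm V}) N x a b :
  let A := porbit g x in let h := (tperm a b * g)%g in
  exchange_cycles M1 M2 I g N A -> a \in A -> b \in A -> b != a ->
  indep M2 (g b |: I :\ N a) ->
  [/\ exchange_cycles M1 M2 I h N (porbit h a), porbit h a \subset A,
      #|porbit h a| < #|A|
    & forall j, (g j \in porbit h a) + (j == a) = (j \in porbit h a) + (j == b)].
Proof.
move=> A h [Ninj AP] aA bA nba iab.
have hE j : h j = if j == a then g b else if j == b then g a else g j.
  rewrite permM; case: tpermP => [->|->|/eqP/negbTE-> /eqP/negbTE->//]; first by rewrite eqxx.
  by rewrite (negbTE nba) eqxx.
have hA j : j \in A -> h j \in A.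
  by move=> jA; rewrite hE; case: eqP => _; [|case: eqP => _]; have [] := AP _ bA;
    have [] := AP _ aA; have [] := AP _ jA.
have sA : porbit h a \subset A.
  apply/subsetP => j /porbitP[i ->]; elim: i => [|i IH]; first by rewrite expg0 perm1.
  by rewrite expgSr permM hA.
have aOb : a \in porbit g b.
  by move: aA bA; rewrite /A -!eq_porbit_mem => /eqP-> /eqP->.
have nbP : b \notin porbit h a by apply: tperm_notin_porbit => //; rewrite eq_sym.
have hP j : (h j \in porbit h a) = (j \in porbit h a).
  have -> : h j = (h ^+ 1)%g j by rewrite expg1.
  by rewrite ![_ \in porbit h a]porbit_sym -!eq_porbit_mem porbit_perm.
split => //.
- split; first by move=> j k jP kP; apply: Ninj; apply: (subsetP sA).
  move=> j jP; have [njI gj NjI i1 i2] := AP _ (subsetP sA _ jP); split => //.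
    by rewrite hP.
  (* The chord justifies [h a = g b]. Nothing is known about the exchange of [N b] for [h b = g a],
     but [b] is not on the orbit. *)
  rewrite hE; case: eqP => [->//|_]; case: eqP => // jb.
  by rewrite -jb jP in nbP.
- by apply: proper_card; apply/properP; split => //; exists b.
- move=> j; case: (j =P a) => [->|/eqP ja].
    rewrite porbit_id [a == b]eq_sym (negbTE nba).
    have <- : h b = g a by rewrite hE (negbTE nba) eqxx.
    by rewrite hP (negbTE nbP).
  case: (j =P b) => [->|/eqP jb].
    have <- : h a = g b by rewrite hE eqxx.
    by rewrite hP porbit_id (negbTE nbP).
  by have <- : h j = g j; [rewrite hE (negbTE ja) (negbTE jb)|rewrite hP].
Qed.

(* Each step of the walk is a chord and cuts off a shorter cycle.  Along g, these
   cycles are entered and left as often at every vertex, so that they cover all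
   elements of A equally often. *)
Lemma closed_walk_cover (V : finType) (M1 M2 : matroid V) I p (g : {perm V}) N x k f y :
  let A := porbit g x in
  exchange_cycles M1 M2 I g N A ->
  (forall (h : {perm V}) a, exchange_cycles M1 M2 I h N (porbit h a) ->
     #|porbit h a| < #|A| ->
     exchange_cover M1 M2 I p (fun j => j \in porbit h a)
       (fun i => i \in N @: porbit h a)) ->
  0 < k -> iter k f y = y ->
  (forall l, let a := iter l f y in
     [/\ a \in A, f a \in A, f a != a & indep M2 (g (f a) |: I :\ N a)]) ->
  exchange_cover M1 M2 I p (fun j => j \in A) (fun i => i \in N @: A).
Proof.
move=> A gA IH k0 ky walk.
pose a l := iter l f y.
pose P l := porbit (tperm (a l) (a l.+1) * g)%g (a l).
have aP l : [/\ exchange_cycles M1 M2 I (tperm (a l) (a l.+1) * g)%g N (P l),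
    P l \subset A, #|P l| < #|A|
  & forall j, (g j \in P l) + (j == a l) = (j \in P l) + (j == a l.+1)].
  by have [? ? ? ?] := walk l; apply: chord_cycle.
pose c j := \sum_(l < k) (j \in P l).
have cg j : c (g j) = c j.
  have shift : \sum_(l < k) (j == a l.+1) = \sum_(l < k) (j == a l).
    have ak : a k = a 0 by [].
    case: k k0 ky ak @c => // k _ _ ak _; rewrite big_ord_recr [RHS]big_ord_recl /= addnC.
    by move: ak => /= ->.
  apply/eqP; rewrite -(eqn_add2r (\sum_(l < k) (j == a l))) -[in X in _ == X]shift.
  rewrite -!big_split /=; apply/eqP; apply: eq_bigr => l _.
  by have [_ _ _ ->] := aP l.
have cA j : j \in A -> c j = c x.
  move=> /porbitP[i ->]; elim: i => [|i IHi]; first by rewrite expg0 perm1.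
  by rewrite expgSr permM cg.
have yA : y \in A by have [] := walk 0.
(* The first shorter cycle passes through [y], so the common multiplicity is positive and can be
   divided out. *)
have cx0 : 0 < c x.
  rewrite -(cA _ yA) /c (bigD1 (Ordinal k0)) //= addn_gt0.
  by rewrite /P /= porbit_id.
have cnA j : j \notin A -> c j = 0.
  move=> njA; rewrite /c big1 // => l _.
  by case: (boolP (j \in P l)) => // jP; have [_ /subsetP/(_ _ jP)] := aP l; rewrite (negbTE njA).
have cov l : exchange_cover M1 M2 I p (fun j => j \in P l) (fun i => i \in N @: P l).
  by have [? ? ? ?] := aP l; apply: IH.
apply: (exchange_cover_scale cx0 (exchange_cover_sum k cov)) => [j|i].
  rewrite -[LHS]/(c j); case: (boolP (j \in A)) => jA; first by rewrite muln1 cA.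
  by rewrite muln0 cnA.
have [/imsetP[j jA ->]|niN] := boolP (i \in N @: A).
  rewrite muln1 -(cA j jA); apply: eq_bigr => l _; congr nat_of_bool.
  apply/imsetP/idP => [[j' j'P Njj']|jP]; last by exists j.
  have [_ sP _ _] := aP l.
  by rewrite (gA.1 _ _ jA (subsetP sP _ j'P) Njj').
rewrite muln0 big1 // => l _.
case: (boolP (i \in N @: P l)) => // /imsetP[j jP iE].
case/negP: niN; rewrite iE; apply: imset_f.
by have [_ /subsetP/(_ _ jP)] := aP l.
Qed.

Lemma count_traject (T : eqType) (f : T -> T) (P : pred T) y k :
  count P (traject f y k) = \sum_(l < k) P (iter l f y).
Proof.
elim: k y => [|k IH] y; first by rewrite big_ord0.
by rewrite big_ord_recl /= IH; congr (_ + _); apply: eq_bigr => l _; rewrite -iterSr.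
Qed.

Lemma has_leq_count (T : Type) (P : pred T) s : (has P s : nat) <= count P s.
Proof. by rewrite has_count; case: (count P s). Qed.

Lemma sum_porbit (V : finType) (g : {perm V}) x l (F : V -> nat) :
  \sum_(z in porbit g x) F (iter l g z) = \sum_(z in porbit g x) F z.
Proof.
rewrite [RHS](reindex_inj (@perm_inj _ (g ^+ l)%g)) /=.
apply: eq_big => [z|z _]; last by rewrite permX.
by rewrite ![_ \in porbit g x]porbit_sym -!eq_porbit_mem porbit_perm.
Qed.

(** For [M1] the partner of an inserted [j] is [N j], for [M2] it is [N] of the predecessor of [j].
    Inserting [p] consecutive elements therefore requires deleting the [p.+1] elements next to them
    on the cycle. All rotations of such a segment together insert every element [p] times; a cycle
    of at most [p] elements is exchanged as a whole, [p] times. *)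
Lemma chop_cycle_cover (V : finType) (M1 M2 : matroid V) I p (g : {perm V}) N x :
  let A := porbit g x in
  0 < p -> {in A &, injective N} ->
  (forall X : {set V}, X \subset A -> indep M1 (X :|: (I :\: N @: X))) ->
  (forall X : {set V}, X \subset A -> indep M2 (g @: X :|: (I :\: N @: X))) ->
  exchange_cover M1 M2 I p (fun j => j \in A) (fun i => i \in N @: A).
Proof.
move=> A p0 Ninj H1 H2.
have gA z : z \in A -> g z \in A.
  by move=> /porbitP[l ->]; rewrite -(permM _ g) -expgSr mem_porbit.
have iterA l z : z \in A -> iter l g z \in A by move=> zA; elim: l => //= l; apply: gA.
have [leAp|ltpA] := leqP #|A| p.
  exists 1, (nseq p (A, N @: A)); split => //.
  - apply/allP => _ /nseqP[-> _].
    have gAE : g @: A = A.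
      apply/eqP; rewrite eqEcard card_imset ?leqnn ?andbT; last exact: perm_inj.
      by apply/subsetP => _ /imsetP[z zA ->]; apply: gA.
    have i2 : indep M2 (A :|: (I :\: N @: A)) by rewrite -{1}gAE H2.
    rewrite /short_exchange /= H1 // i2 leAp /=; apply/andP; split; last first.
      exact: leq_trans (leq_imset_card _ _) (leqW leAp).
    by apply/set0Pn; exists x; apply: porbit_id.
  - by move=> j; rewrite big_nseq iter_addn_0 mul1n mulnC.
  - by move=> i; rewrite big_nseq iter_addn_0 mul1n mulnC leq_mul2r leqnSn orbT.
pose ex z := ([set j in traject g (g z) p], [set i in map N (traject g z p.+1)]).
have trA z l : z \in A -> {subset traject g z l <= A}.
  by move=> zA _ /trajectP[i _ ->]; apply: iterA.
exists 1, [seq ex z | z <- enum A]; split => //.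
- apply/allP => t /mapP[z]; rewrite mem_enum => zA ->.
  rewrite /short_exchange /ex /= !cardsE; apply/and5P; split.
  + have /H1 : [set j in traject g (g z) p] \subset A.
      by apply/subsetP => j; rewrite inE; apply/trA/gA.
    apply: indepS; apply: setUS; apply: setDS; apply/subsetP => _ /imsetP[j + ->].
    by rewrite !inE => jt; rewrite map_f ?orbT.
  + have /H2 : [set j in traject g z p] \subset A.
      by apply/subsetP => j; rewrite inE; apply: trA.
    apply: indepS; apply: setUSS; last first.
      apply: setDS; apply/subsetP => _ /imsetP[j + ->].
      rewrite !in_set -map_cons -trajectS trajectSr => jt.
      by rewrite map_f // mem_rcons inE jt orbT.
    apply/subsetP => j; rewrite inE => /trajectP[l lp ->].
    rewrite -iterSr iterS; apply: imset_f; rewrite inE; apply/trajectP; by exists l.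
  + apply/set0Pn; exists (g z); rewrite inE; apply/trajectP; by exists 0.
  + by apply: leq_trans (card_size _) _; rewrite size_traject.
  + by apply: leq_trans (card_size _) _; rewrite /= size_map size_traject.
- move=> j; rewrite big_map big_enum /= mul1n.
  (* As [p < #|A|], a segment does not overlap itself, and membership can be counted by
     positions. *)
  transitivity (\sum_(z in A) \sum_(l < p) (j == iter l.+1 g z)).
    apply: eq_bigr => z zA; rewrite inE -count_uniq_mem ?count_traject.
      by apply: eq_bigr => l _; rewrite -iterSr eq_sym.
    have := uniq_traject_porbit g (g z).
    have -> : porbit g (g z) = A.
      by apply/eqP; rewrite eq_porbit_mem; apply: gA.
    by rewrite -(subnK (ltnW ltpA)) addnC trajectD cat_uniq => /and3P[].
  rewrite exchange_big /= (eq_bigr (fun=> (j \in A) : nat)) => [|l _].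
    by rewrite sum_nat_const card_ord.
  rewrite (sum_porbit g x l.+1 (fun z => j == z)).
  have [jA|jnA] := boolP (j \in A).
    by rewrite (bigD1 j) //= eqxx big1 // => z /andP[_ /negbTE]; rewrite eq_sym => ->.
  by rewrite big1 // => z zA; case: eqP => // jz; rewrite jz zA in jnA.
- move=> i; rewrite big_map big_enum /= mul1n.
  apply: (@leq_trans (\sum_(z in A) \sum_(l < p.+1) (i == N (iter l g z)))).
    apply: leq_sum => z zA; rewrite -(count_traject g (fun y => i == N y)).
    rewrite in_set -map_cons -trajectS; apply: leq_trans (has_leq_count _ _).
    rewrite leq_eqVlt; apply/orP; left; apply/eqP; congr nat_of_bool.
    by apply/mapP/hasP => [[y yt ->]|[y yt /eqP ->]]; exists y.
  rewrite exchange_big /= (eq_bigr (fun=> \sum_(z in A) (i == N z))) => [|l _]; last first.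
    exact: (sum_porbit g x l (fun z => i == N z)).
  rewrite sum_nat_const card_ord leq_mul2l /=.
  have [/imsetP[j jA ->]|niN] := boolP (i \in N @: A).
    rewrite (bigD1 j) //= eqxx big1 // => z /andP[zA /negbTE zj].
    by case: eqP => // /(Ninj _ _ jA zA) jz; rewrite jz eqxx in zj.
  by rewrite big1 // => z zA; case: eqP => // iN; rewrite iN imset_f in niN.
Qed.

Lemma sorted_indep (V : finType) (M : matroid V) (I A X : {set V}) (phi nu : V -> V) s :
  indep M I -> uniq s -> s =i A -> {in A &, injective phi} -> {in A &, injective nu} ->
  {in A, forall a, [/\ phi a \notin I, nu a \in I & indep M (phi a |: I :\ nu a)]} ->
  pairwise (fun a b => ~~ indep M (phi b |: I :\ nu a)) s -> X \subset A ->
  indep M (phi @: X :|: (I :\: nu @: X)).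
Proof.
move=> iI us sA phiI nuI AP ps sX; pose s' := [seq a <- s | a \in X].
have s'X : s' =i X.
  by move=> z; rewrite mem_filter sA andb_idr // => /(subsetP sX).
have s'A : {subset s' <= A} by move=> z; rewrite s'X => /(subsetP sX).
have mapE (f : V -> V) : [set z in map f s'] = f @: X.
  apply/setP => z; rewrite inE; apply/mapP/imsetP => -[y yX ->]; exists y => //.
    by rewrite -s'X.
  by rewrite s'X.
rewrite -!mapE; apply: triangular_indep => //.
- rewrite map_inj_in_uniq ?filter_uniq // => y z ys zs; exact: phiI (s'A _ ys) (s'A _ zs).
- rewrite map_inj_in_uniq ?filter_uniq // => y z ys zs; exact: nuI (s'A _ ys) (s'A _ zs).
- by move=> a /s'A; apply: AP.
- exact: pairwise_filter.
Qed.

(** Traversed backwards, a cycle has its two matroids interchanged, so that closed walks of chords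
    need to be treated for the second matroid only. *)
Lemma exchange_cycles_sym (V : finType) (M1 M2 : matroid V) I (g : {perm V}) N
    (A : {set V}) :
  {in A, forall j, g^-1%g j \in A} -> exchange_cycles M1 M2 I g N A ->
  exchange_cycles M2 M1 I g^-1%g (fun j => N (g^-1%g j)) A.
Proof.
move=> gA [Ninj AP]; split.
  by move=> j k jA kA /(Ninj _ _ (gA _ jA) (gA _ kA)) /perm_inj.
move=> j jA; have [njI ? ? ? _] := AP _ jA; have [? ? ? ?] := AP _ (gA _ jA).
by rewrite permKV; split => //; apply: gA.
Qed.

(** Induction on the length of the cycle. For either matroid, a closed walk of chords reduces the
    cycle to shorter ones; if neither matroid has one, both chord relations can be sorted and the
    cycle can be chopped. The induction ranges over both matroids, because reversing a cycle swaps
    them. *)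
Lemma cycle_cover (V : finType) (M1 M2 : matroid V) I p (g : {perm V}) N x :
  0 < p -> indep M1 I -> indep M2 I -> exchange_cycles M1 M2 I g N (porbit g x) ->
  exchange_cover M1 M2 I p (fun j => j \in porbit g x) (fun i => i \in N @: porbit g x).
Proof.
move=> p0; move: {2}#|porbit g x| (leqnn #|porbit g x|) => d.
elim: d M1 M2 g N x => [|d IH] M1 M2 g N x.
  by rewrite leqNgt lt0n card_porbit_neq0.
move=> led i1 i2 gA; pose A := porbit g x.
have gVA : {in A, forall j, g^-1%g j \in A}.
  move=> j; rewrite /A -porbitV => /porbitP[l ->].
  by rewrite -(permM _ g^-1%g) -expgSr mem_porbit.
have lt_d (B : {set V}) : #|B| < #|A| -> #|B| <= d.
  by move=> ltB; rewrite -ltnS; apply: leq_trans ltB led.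
have [[s2 [us2 s2A ps2]]|[k [f [y [k0 ky walk]]]]] :=
    sorted_or_walk (fun a b => indep M2 (g b |: I :\ N a)) A; last first.
  by apply: closed_walk_cover k0 ky walk => // h a gh lth; apply: IH => //; apply: lt_d.
(* A chord for M1 is a chord for the second matroid of the reversed cycle. *)
have gA' := exchange_cycles_sym gVA gA.
pose N' j := N (g^-1%g j).
have [[s1 [us1 s1A ps1]]|[k [f [y [k0 ky walk]]]]] :=
    sorted_or_walk (fun a b => indep M1 (g^-1%g b |: I :\ N' a)) A; last first.
  have H : exchange_cover M2 M1 I p (fun j => j \in A) (fun i => i \in N' @: A).
    rewrite /A -porbitV; apply: closed_walk_cover k0 ky _; rewrite porbitV //.
    by move=> h a gh lth; apply: IH => //; apply: lt_d.
  apply: (exchange_cover_scale (w := 1) _ (exchange_cover_sym H)) => // j; rewrite mul1n //.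
  congr nat_of_bool; apply/imsetP/imsetP => -[z zA ->].
    by exists (g^-1%g z) => //; apply: gVA.
  by exists (g z); [have [] := gA.2 _ zA | rewrite /N' permK].
have [Ninj AP] := gA; have [Ninj' AP'] := gA'.
apply: chop_cycle_cover => // X sX.
  (* The order [s1] belongs to the reversed cycle, whose maps are [g^-1] and [N']. *)
  have -> : X = g^-1%g @: (g @: X).
    by rewrite -imset_comp (eq_imset _ (permK g)) imset_id.
  have -> : N @: (g^-1%g @: (g @: X)) = N' @: (g @: X) by rewrite -imset_comp.
  apply: (sorted_indep i1 us1 s1A) => //.
  - by move=> ? ? _ _ /perm_inj.
  - move=> j jA; have [? ? ? ? _] := AP _ (gVA _ jA); split => //.
  - apply/subsetP => _ /imsetP[z zX ->]; by have [] := AP _ (subsetP sX _ zX).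
apply: (sorted_indep i2 us2 s2A) => //.
- by move=> ? ? _ _ /perm_inj.
- move=> j jA; have [? gjA ? ? ?] := AP _ jA; have [? ? ? ? _] := AP _ gjA; split => //.
Qed.

(** * Covers for arbitrary pairs of common independent sets *)

Lemma exchange_cycles_cover (V : finType) (M1 M2 : matroid V) I p (g : {perm V}) N A :
  0 < p -> indep M1 I -> indep M2 I -> exchange_cycles M1 M2 I g N A ->
  exchange_cover M1 M2 I p (fun j => j \in A) (fun i => i \in N @: A).
Proof.
move=> p0 i1 i2; move: {2}#|A| (leqnn #|A|) => d; elim: d A => [|d IH] A.
  rewrite leqn0 cards_eq0 => /eqP-> _.
  apply: (exchange_cover_scale (w := 1) _ (exchange_cover0 M1 M2 I p)) => // j.
    by rewrite inE.
  by rewrite imset0 inE.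
have [->|/set0Pn[x xA]] := eqVneq A set0; first by move=> _; apply: IH; rewrite cards0.
move=> led [Ninj AP]; pose P := porbit g x.
have sP : P \subset A.
  apply/subsetP => _ /porbitP[l ->]; elim: l => [|l IHl]; first by rewrite expg0 perm1.
  by rewrite expgSr permM; have [] := AP _ IHl.
have gP z : (g z \in P) = (z \in P).
  have -> : g z = (g ^+ 1)%g z by rewrite expg1.
  by rewrite ![_ \in P]porbit_sym -!eq_porbit_mem porbit_perm.
have cP : exchange_cycles M1 M2 I g N P.
  split; first by move=> j k jP kP; apply: Ninj; apply: (subsetP sP).
  by move=> j jP; have [? ? ? ? ?] := AP _ (subsetP sP _ jP); split; rewrite ?gP.
have cD : exchange_cycles M1 M2 I g N (A :\: P).
  split; first by move=> j k /setDP[jA _] /setDP[kA _]; apply: Ninj.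
  move=> j /setDP[jA njP]; have [? ? ? ? ?] := AP _ jA.
  by split => //; rewrite inE gP njP.
have lt : #|A :\: P| <= d.
  rewrite -ltnS; apply: leq_trans led; apply: proper_card.
  by apply/properP; split; [apply: subsetDl | exists x => //; rewrite inE porbit_id].
have covU := exchange_cover_add (cycle_cover p0 i1 i2 cP) (IH _ lt cD).
apply: (exchange_cover_scale (w := 1) _ covU) => // j; rewrite mul1n.
  by rewrite !inE; case: (boolP (j \in P)) => // /(subsetP sP) ->.
have [/imsetP[z zP ->]|nP] /= := boolP (j \in N @: P).
  have -> : (N z \in N @: (A :\: P)) = false.
    apply/negP => /imsetP[z' z'D Nz']; have [z'A nz'P] := setDP z'D.
    by rewrite -(Ninj _ _ (subsetP sP _ zP) z'A Nz') zP in nz'P.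
  by rewrite imset_f ?(subsetP sP).
rewrite add0n; congr nat_of_bool; apply/imsetP/imsetP => -[z zA jE]; exists z => //.
  by case/setDP: zA.
by rewrite inE zA andbT; apply: contra nP => zP; rewrite jE imset_f.
Qed.

(** The matchings [N] for [M1] and [h] for [M2] are bijections from [D] to [E]. Their quotient, [N]
    followed by the inverse of [h], permutes [D], and its orbits are the alternating cycles; it is
    extended by the identity to a permutation of [V]. *)
Lemma equicardinal_cover (V : finType) (M1 M2 : matroid V) (I J : {set V}) p :
  0 < p -> indep M1 I -> indep M2 I -> indep M1 J -> indep M2 J -> #|I| = #|J| ->
  exchange_cover M1 M2 I p (fun j => j \in J :\: I) (fun i => i \in I :\: J).
Proof.
move=> p0 iI1 iI2 iJ1 iJ2 cIJ.
have [N [Ninj NP]] := exchange_matching iI1 iJ1 cIJ.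
have [h [hinj hP]] := exchange_matching iI2 iJ2 cIJ.
set D := J :\: I in Ninj NP hinj hP *; set E := I :\: J in NP hP *.
have cDE : #|D| = #|E|.
  by rewrite /D /E; have := cardsID I J; have := cardsID J I; rewrite setIC; lia.
have imE f : {in D &, injective f} -> (forall j, j \in D -> f j \in E) -> f @: D = E.
  move=> finj fE; apply/eqP; rewrite eqEcard card_in_imset // cDE leqnn andbT.
  by apply/subsetP => _ /imsetP[j jD ->]; apply: fE.
have hE : h @: D = E by apply: imE => // j /hP[].
have NE : N @: D = E by apply: imE => // j /NP[].
pose g0 j := if j \in D then odflt j [pick j' in D | h j' == N j] else j.
have g0D j : j \in D -> g0 j \in D /\ h (g0 j) = N j.
  move=> jD; rewrite /g0 jD; case: pickP => [j' /andP[? /eqP]//|no].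
  have : N j \in h @: D by rewrite hE -NE imset_f.
  by case/imsetP => j' j'D /esym hj; have := no j'; rewrite /= j'D hj eqxx.
have g0n j : j \notin D -> g0 j = j by move=> jD; rewrite /g0 (negbTE jD).
have g0inj : injective g0.
  move=> j k; have [jD|jD] := boolP (j \in D); have [kD|kD] := boolP (k \in D).
  - move=> gE; apply: Ninj => //; have [_ <-] := g0D _ jD.
    by rewrite gE; have [_ ->] := g0D _ kD.
  - by rewrite (g0n k) // => gE; rewrite -gE in kD; have [] := g0D _ jD; rewrite (negbTE kD).
  - by rewrite (g0n j) // => gE; rewrite gE in jD; have [] := g0D _ kD; rewrite (negbTE jD).
  - by rewrite !g0n.
rewrite -NE; apply: (exchange_cycles_cover (g := perm g0inj)) => //; split => // j jD.
have [gD hg] := g0D _ jD; have [NjE i1] := NP _ jD; have [_ i2] := hP _ gD.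
rewrite permE; split => //; last by rewrite -hg.
  by case/setDP: jD.
by case/setDP: NjE.
Qed.

(* In the direct sum with a free matroid, any independent set can be padded to size
   #|V| by the copies of the elements outside it. *)
Definition free_ext (V : finType) (M : matroid V) : matroid (V + V)%type.
Proof.
exists (fun X : {set V + V} => indep M [set v | inl v \in X]).
- by apply: indepS (indep0 M); apply/subsetP => x; rewrite !inE.
- by move=> A B sAB; apply: indepS; apply/subsetP => x; rewrite !inE; apply/subsetP.
move=> A B iA iB ltAB.
have cE (X : {set V + V}) : #|X| = #|[set v | inl v \in X]| + #|[set v | inr v \in X]|.
  have cs (T : finType) (f : T -> V + V) : injective f ->
      #|[set v | f v \in X]| = \sum_(v : T) (f v \in X).
    by move=> _; rewrite -sum1_card big_mkcond; apply: eq_bigr => v _; rewrite inE; case: (_ \in _).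
  rewrite !cs; [|by move=> ? ? []|by move=> ? ? []].
  by rewrite -sum1_card big_mkcond big_sumType /=; congr (_ + _); apply: eq_bigr => v _; case: (_ \in _).
have [sR|/subsetPn[v]] := boolP ([set v | inr v \in B] \subset [set v | inr v \in A]).
  have [|x] := indep_aug iA iB; first by have := subset_leq_card sR; rewrite (cE A) (cE B) in ltAB; lia.
  rewrite !inE => xBA ix; exists (inl x); first by rewrite inE.
  by apply: indepS ix; apply/subsetP => y; rewrite !inE.
rewrite !inE => vB vA; exists (inr v); first by rewrite inE vA.
by apply: indepS iA; apply/subsetP => y; rewrite !inE.
Defined.

(** Padding makes the two sets equicardinal, and dropping the copies afterwards only shrinks the
    exchanges. Some of them may then insert nothing, so a bound on [size F] takes the place of the
    nonemptiness of [t.1]. *)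
Lemma short_exchange_cover (V : finType) (M1 M2 : matroid V) (I J : {set V}) p :
  0 < p -> indep M1 I -> indep M2 I -> indep M1 J -> indep M2 J ->
  exists Q (F : seq ({set V} * {set V})),
    [/\ 0 < Q /\ size F <= Q * p * #|V|,
        {in F, forall t, [/\ indep M1 (t.1 :|: (I :\: t.2)), indep M2 (t.1 :|: (I :\: t.2)),
           #|t.1| <= p & #|t.2| <= p.+1]},
        forall j, \sum_(t <- F) (j \in t.1) = Q * p * (j \in J :\: I)
      & forall i, \sum_(t <- F) (i \in t.2) <= Q * p.+1 * (i \in I :\: J)].
Proof.
move=> p0 iI1 iI2 iJ1 iJ2.
pose pad (X : {set V}) : {set V + V} :=
  [set z | match z with inl v => v \in X | inr v => v \notin X end].
have padK (X : {set V}) : [set v | inl v \in pad X] = X by apply/setP => v; rewrite !inE.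
have cpad (X : {set V}) : #|pad X| = #|V|.
  rewrite -sum1_card big_mkcond big_sumType /= -big_split /= -sum1_card.
  by apply: eq_bigr => v _; rewrite !inE; case: (_ \in _).
have [|||||Q [F [Q0 vF cF rF]]] := @equicardinal_cover _ (free_ext M1) (free_ext M2)
  (pad I) (pad J) p p0; rewrite /= ?padK ?cpad //.
pose res (X : {set V + V}) := [set v | inl v \in X].
have cres (X : {set V + V}) : #|res X| <= #|X|.
  rewrite -(card_imset (mem (res X)) (@inl_inj V V)); apply: subset_leq_card.
  by apply/subsetP => _ /imsetP[v + ->]; rewrite inE.
exists Q, [seq (res t.1, res t.2) | t <- F]; split.
- split => //; rewrite size_map.
  have -> : size F = \sum_(t <- F) 1 by rewrite big_const_seq count_predT iter_addn_0 mul1n.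
  (* Before the copies are dropped, every exchange inserts at least one element, so the total number
     of insertions bounds the number of exchanges. *)
  apply: (@leq_trans (\sum_(t <- F) \sum_(j : V + V) (j \in t.1))).
    rewrite big_seq [X in _ <= X]big_seq; apply: leq_sum => t tF.
    have /and5P[_ _ t0 _ _] := allP vF _ tF.
    rewrite -[X in _ <= X]big_mkcond /= sum1_card; rewrite card_gt0 //.
  rewrite exchange_big /= (eq_bigr _ (fun j _ => cF j)) -big_distrr /= leq_mul2l; apply/orP; right.
  rewrite -[X in X <= _]big_mkcond /= sum1_card -(cpad J); apply: subset_leq_card.
  exact: subsetDl.
- move=> _ /mapP[t tF ->]; have /and5P[i1 i2 _ c1 c2] := allP vF _ tF.
  split => /=; last 2 first.
  + exact: leq_trans (cres _) c1.
  + exact: leq_trans (cres _) c2.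
  + by move: i1 => /=; apply: indepS; apply/subsetP => v; rewrite !inE.
  + by move: i2 => /=; apply: indepS; apply/subsetP => v; rewrite !inE.
- move=> j; rewrite big_map /= -[LHS]/(\sum_(t <- F) _); under eq_bigr do rewrite inE.
  by rewrite cF !inE.
- move=> i; rewrite big_map /=; under eq_bigr do rewrite inE.
  by have := rF (inl i); rewrite !inE.
Qed.

End MatroidExchange.

(** * The gain of a local search step *)

Definition pair_value (c1 c2 : nat) (a b : bool) : nat :=
  if a then if b then c2 else c1 else if b then c1 else 0.

Definition score (R : realFieldType) (n : nat) (w : nat -> nat -> R) (c1 c2 : nat)
    (S : {set 'I_n}) : R :=
  \sum_(i < n) \sum_(j < n) w i j * (pair_value c1 c2 (i \in S) (j \in S))%:R.

Section PairValue.
Local Open Scope nat_scope.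

(* The values 2 and 3 of an edge with one, resp. two, endpoints in S make the
   two worst cases (edges joining S \ O to O \ S, and edges inside S \ O) lose the
   same factor 3/2. *)
Lemma pair_exchange_gain (V : finType) (S O : {set V}) p Q
    (F : seq ({set V} * {set V})) (u v : V) :
  (forall j, \sum_(t <- F) (j \in t.1) = Q * p * (j \in O :\: S)) ->
  (forall i, \sum_(t <- F) (i \in t.2) <= Q * p.+1 * (i \in S :\: O)) ->
  2 * (Q * p) * pair_value 1 1 (u \in O) (v \in O) +
    size F * pair_value 2 3 (u \in S) (v \in S) <=
  \sum_(t <- F) pair_value 2 3 (u \in t.1 :|: (S :\: t.2)) (v \in t.1 :|: (S :\: t.2)) +
    3 * (Q * p.+1) * pair_value 1 1 (u \in S) (v \in S).
Proof.
move=> cF rF; set X := \sum_(t <- F) pair_value _ _ _ _.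
have := cF u; have := cF v; have := rF u; have := rF v; rewrite !in_setD.
set au := \sum_(t <- F) (u \in t.1); set av := \sum_(t <- F) (v \in t.1).
set ru := \sum_(t <- F) (u \in t.2); set rv := \sum_(t <- F) (v \in t.2).
(* A linear lower bound on the pair's value after one exchange, valid for all membership patterns of
   [u] and [v], can be summed over [F]. Each case below supplies the bounds from which [lia] derives
   the claim. *)
have lin c0 c1 c2 c3 c4 k :
  (forall t : {set V} * {set V}, c0 + c1 * (u \in t.1) + c2 * (v \in t.1) <=
     k * pair_value 2 3 (u \in t.1 :|: (S :\: t.2)) (v \in t.1 :|: (S :\: t.2)) +
     (c3 * (u \in t.2) + c4 * (v \in t.2))) ->
  c0 * size F + c1 * au + c2 * av <= k * X + (c3 * ru + c4 * rv).
  move=> H; have -> : c0 * size F = \sum_(t <- F) c0.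
    by rewrite big_const_seq count_predT iter_addn_0.
  by rewrite !big_distrr /= -!big_split /=; apply: leq_sum => t _; apply: H.
have [uS|uS] := boolP (u \in S); have [vS|vS] := boolP (v \in S) => /=.
- have /lin : forall t : {set V} * {set V}, 6 + 0 * (u \in t.1) + 0 * (v \in t.1) <=
     2 * pair_value 2 3 (u \in t.1 :|: (S :\: t.2)) (v \in t.1 :|: (S :\: t.2)) +
     (3 * (u \in t.2) + 3 * (v \in t.2)).
    by move=> t; rewrite !inE uS vS; do 4 case: (_ \in _).
  have /lin : forall t : {set V} * {set V}, 3 + 0 * (u \in t.1) + 0 * (v \in t.1) <=
     1 * pair_value 2 3 (u \in t.1 :|: (S :\: t.2)) (v \in t.1 :|: (S :\: t.2)) +
     (3 * (u \in t.2) + 1 * (v \in t.2)).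
    by move=> t; rewrite !inE uS vS; do 4 case: (_ \in _).
  have /lin : forall t : {set V} * {set V}, 3 + 0 * (u \in t.1) + 0 * (v \in t.1) <=
     1 * pair_value 2 3 (u \in t.1 :|: (S :\: t.2)) (v \in t.1 :|: (S :\: t.2)) +
     (1 * (u \in t.2) + 3 * (v \in t.2)).
    by move=> t; rewrite !inE uS vS; do 4 case: (_ \in _).
    by case: (u \in O); case: (v \in O); rewrite /pair_value /=; lia.
- have /lin : forall t : {set V} * {set V}, 2 + 0 * (u \in t.1) + 1 * (v \in t.1) <=
     1 * pair_value 2 3 (u \in t.1 :|: (S :\: t.2)) (v \in t.1 :|: (S :\: t.2)) +
     (2 * (u \in t.2) + 0 * (v \in t.2)).
    by move=> t; rewrite !inE uS (negbTE vS); do 4 case: (_ \in _).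
  by case: (u \in O); case: (v \in O); rewrite /pair_value /=; lia.
- have /lin : forall t : {set V} * {set V}, 2 + 1 * (u \in t.1) + 0 * (v \in t.1) <=
     1 * pair_value 2 3 (u \in t.1 :|: (S :\: t.2)) (v \in t.1 :|: (S :\: t.2)) +
     (0 * (u \in t.2) + 2 * (v \in t.2)).
    by move=> t; rewrite !inE vS (negbTE uS); do 4 case: (_ \in _).
  by case: (u \in O); case: (v \in O); rewrite /pair_value /=; lia.
- have /lin : forall t : {set V} * {set V}, 0 + 3 * (u \in t.1) + 3 * (v \in t.1) <=
     2 * pair_value 2 3 (u \in t.1 :|: (S :\: t.2)) (v \in t.1 :|: (S :\: t.2)) +
     (0 * (u \in t.2) + 0 * (v \in t.2)).
    by move=> t; rewrite !inE (negbTE vS) (negbTE uS); do 4 case: (_ \in _).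
  have /lin : forall t : {set V} * {set V}, 0 + 2 * (u \in t.1) + 0 * (v \in t.1) <=
     1 * pair_value 2 3 (u \in t.1 :|: (S :\: t.2)) (v \in t.1 :|: (S :\: t.2)) +
     (0 * (u \in t.2) + 0 * (v \in t.2)).
    by move=> t; rewrite !inE (negbTE vS) (negbTE uS); do 4 case: (_ \in _).
  have /lin : forall t : {set V} * {set V}, 0 + 0 * (u \in t.1) + 2 * (v \in t.1) <=
     1 * pair_value 2 3 (u \in t.1 :|: (S :\: t.2)) (v \in t.1 :|: (S :\: t.2)) +
     (0 * (u \in t.2) + 0 * (v \in t.2)).
    by move=> t; rewrite !inE (negbTE vS) (negbTE uS); do 4 case: (_ \in _).
  by case: (u \in O); case: (v \in O); rewrite /pair_value /=; lia.
Qed.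

End PairValue.

Lemma score_ge0 (R : realFieldType) n (w : nat -> nat -> R) c1 c2 (S : {set 'I_n}) :
  (forall i j, 0 <= w i j) -> 0 <= score w c1 c2 S.
Proof. by move=> w0; do 2 apply: sumr_ge0 => ? _; rewrite mulr_ge0. Qed.

Lemma potential_le_coverage (R : realFieldType) n (w : nat -> nat -> R) (S : {set 'I_n}) :
  (forall i j, 0 <= w i j) -> score w 2 3 S <= 3 * score w 1 1 S.
Proof.
move=> w0; rewrite /score mulr_sumr; apply: ler_sum => i _; rewrite mulr_sumr.
apply: ler_sum => j _; rewrite mulrCA ler_wpM2l // -natrM ler_nat.
by rewrite /pair_value; do 2 case: (_ \in _).
Qed.

(** The scores after the exchanges of the cover are summed in two ways: each is at most the old
    score plus [g], and edge by edge the sum is bounded below. The terms with [size F] copies of the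
    old score cancel, and [size F <= Q * p * n] makes the error independent of [Q]. The radius
    [(2 * p).+1] is [p] insertions plus [p.+1] deletions. *)
Lemma local_gain (R : realFieldType) n (w : nat -> nat -> R) (M1 M2 : matroid 'I_n)
    (S O : {set 'I_n}) (p : nat) (g : R) :
  (forall i j, 0 <= w i j) -> (0 < p)%N ->
  indep M1 S -> indep M2 S -> indep M1 O -> indep M2 O ->
  (forall U : {set 'I_n}, indep M1 U -> indep M2 U ->
     (#|(S :\: U) :|: (U :\: S)| <= (2 * p).+1)%N -> score w 2 3 U <= score w 2 3 S + g) ->
  (2 * p)%:R * score w 1 1 O <= (3 * p.+1)%:R * score w 1 1 S + (p * n)%:R * g.
Proof.
move=> w0 p0 S1 S2 O1 O2 gP.
(* Needed to replace [size F] by its upper bound in front of [g]. *)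
have g0 : 0 <= g.
  have := gP S S1 S2; rewrite setDv setU0 cards0 => /(_ isT).
  by rewrite lerDl.
have [Q [F [[Q0 sF] vF cF rF]]] := short_exchange_cover p0 S1 S2 O1 O2.
pose St (t : {set 'I_n} * {set 'I_n}) := t.1 :|: (S :\: t.2).
have upper : \sum_(t <- F) score w 2 3 (St t) <= (size F)%:R * (score w 2 3 S + g).
  rewrite big_seq; have -> : (size F)%:R * (score w 2 3 S + g) = \sum_(t <- F | t \in F) (score w 2 3 S + g).
    by rewrite -big_seq big_const_seq count_predT iter_addr addr0 mulr_natl.
  apply: ler_sum => t tF; have [i1 i2 c1 c2] := vF t tF; apply: gP => //.
  have sub : (S :\: St t) :|: (St t :\: S) \subset t.1 :|: t.2.
    apply/subsetP => x; rewrite !inE.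
    by case: (x \in t.1); case: (x \in t.2); case: (x \in S).
  apply: leq_trans (subset_leq_card sub) _; apply: leq_trans (leq_card_setU _ _) _.
  by rewrite mul2n -addnn -addnS leq_add.
have lower : (2 * (Q * p))%:R * score w 1 1 O + (size F)%:R * score w 2 3 S <=
    \sum_(t <- F) score w 2 3 (St t) + (3 * (Q * p.+1))%:R * score w 1 1 S.
  have -> : \sum_(t <- F) score w 2 3 (St t) = \sum_(i < n) \sum_(j < n)
      w i j * (\sum_(t <- F) pair_value 2 3 (i \in St t) (j \in St t))%:R.
    rewrite exchange_big /=; apply: eq_bigr => i _.
    rewrite exchange_big /=; apply: eq_bigr => j _.
    by rewrite natr_sum mulr_sumr.
  rewrite /score !mulr_sumr -!big_split /=; apply: ler_sum => i _.
  rewrite !mulr_sumr -!big_split /=; apply: ler_sum => j _.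
  rewrite ![_%:R * (w i j * _)]mulrCA -!mulrDr ler_wpM2l //.
  by rewrite -!natrM -!natrD ler_nat; apply: pair_exchange_gain.
have sizeF : (size F)%:R * g <= (Q * p * n)%:R * g.
  by rewrite ler_wpM2r // ler_nat; move: sF; rewrite card_ord.
have QR : 0 < Q%:R :> R by rewrite ltr0n.
rewrite -(ler_pM2l QR).
move: lower upper sizeF; rewrite !natrM; lra.
Qed.

(** * Edge weights as sums over ordered pairs *)

Lemma weight_entryE (R : realFieldType) n (G : wgraph R n) (i j : 'I_n) :
  weight_entry G i j = if [set i; j] \in edges G then weight G [set i; j] else 0.
Proof. by rewrite /weight_entry !valK. Qed.

Lemma weight_entry_ge0 (R : realFieldType) n (G : wgraph R n) i j : 0 <= weight_entry G i j.
Proof.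
rewrite /weight_entry; case: insub => // u; case: insub => // v.
by case: ifP => // /weight_ge0.
Qed.

Lemma edge_weight_score (R : realFieldType) n (G : wgraph R n) (S : {set 'I_n}) :
  score (weight_entry G) 1 1 S = 2 * edge_weight G S.
Proof.
rewrite /score pair_big /= /edge_weight mulr_sumr.
transitivity (\sum_(ij : 'I_n * 'I_n | ([set ij.1; ij.2] \in edges G) &&
    ([set ij.1; ij.2] :&: S != set0)) weight G [set ij.1; ij.2]).
  rewrite [RHS]big_mkcond; apply: eq_bigr => -[i j] _ /=; rewrite weight_entryE.
  case: ifP => _ /=; last by rewrite mul0r.
  have -> : [set i; j] :&: S != set0 = (i \in S) || (j \in S).
    apply/set0Pn/orP => [[x]|[iS|jS]].
    - by rewrite !inE => /andP[/orP[] /eqP->]; [left|right].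
    - by exists i; rewrite !inE eqxx iS.
    - by exists j; rewrite !inE eqxx orbT jS.
  by rewrite /pair_value; case: (i \in S); case: (j \in S); rewrite ?mulr1 ?mulr0.
rewrite (partition_big (fun ij : 'I_n * 'I_n => [set ij.1; ij.2])
  (fun e => (e \in edges G) && (e :&: S != set0))) //=.
apply: eq_bigr => e /andP[eG eS].
have /eqP/cards2P[x [y [xy eE]]] := edges_card2 eG.
rewrite (eq_bigl (fun ij : 'I_n * 'I_n => (ij == (x, y)) || (ij == (y, x)))); last first.
  move=> [i j]; rewrite /= eE; apply/andP/orP => [[_ /eqP E]|].
    have ix : i \in [set x; y] by rewrite -E !inE eqxx.
    have jx : j \in [set x; y] by rewrite -E !inE eqxx orbT.
    have xi : x \in [set i; j] by rewrite E !inE eqxx.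
    have yi : y \in [set i; j] by rewrite E !inE eqxx orbT.
    move: ix jx xi yi xy; rewrite !inE !xpair_eqE.
    do 2 (case/orP=> /eqP->); rewrite ?eqxx ?orbb //=.
    - by move=> _ /eqP->; rewrite eqxx.
    - by left.
    - by right.
    - by move=> /eqP->; rewrite eqxx.
  move=> H; suff -> : [set i; j] = [set x; y] by rewrite -eE eG eS eqxx.
  by case: H => /eqP[-> ->] //; rewrite setUC.
rewrite (bigD1 (x, y)) ?eqxx //= (bigD1 (y, x)) /=; last first.
  by rewrite eqxx orbT xpair_eqE eq_sym (negbTE xy).
rewrite big1 => [|ij /andP[/andP[/orP[]->]]] //; rewrite addr0 -eE [[set y; x]]setUC -eE.
by rewrite mulr_natl mulr2n.
Qed.

(** * Timed execution of programs *)

Section ProgramLogic.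
Local Open Scope nat_scope.
Variables (R : realFieldType) (n : nat) (oracle : bool -> {set 'I_n} -> bool).
Implicit Types (s : state R) (c : com) (P : state R -> Prop).

(** Total correctness with a time bound, for a fixed initial state. *)
Definition runs c s (T : nat) P : Prop :=
  exists t s', [/\ exec oracle c s t s', t <= T & P s'].

Lemma runs_weaken c s T T' P P' :
  runs c s T P -> T <= T' -> (forall s', P s' -> P' s') -> runs c s T' P'.
Proof.
move=> [t [s' [ex tT Ps']]] TT' PP'; exists t, s'; split; first exact: ex.
  exact: leq_trans tT TT'.
exact: PP'.
Qed.

Lemma runs_skip s P : P s -> runs CSkip s 1 P.
Proof. by move=> Ps; exists 1, s; split; [constructor|..]. Qed.

Lemma runs_setN a e1 e2 e s P :
  P (set_nmem s a (nval s e1) (nval s e2) (nval s e)) ->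
  runs (CSetN a e1 e2 e) s (ncost e1 + ncost e2 + ncost e).+1 P.
Proof. by move=> Ps; do 2 eexists; split; [constructor|..]. Qed.

Lemma runs_setR a e1 e2 r s P :
  P (set_rmem s a (nval s e1) (nval s e2) (rval s r)) ->
  runs (CSetR a e1 e2 r) s (ncost e1 + ncost e2 + rcost r).+1 P.
Proof. by move=> Ps; do 2 eexists; split; [constructor|..]. Qed.

Lemma runs_ask k a e d e1 e2 s P :
  P (set_nmem s d (nval s e1) (nval s e2)
       (nat_of_bool (oracle k (row_set n s a (nval s e))))) ->
  runs (CAsk k a e d e1 e2) s (ncost e + ncost e1 + ncost e2).+1 P.
Proof. by move=> Ps; do 2 eexists; split; [constructor|..]. Qed.

Lemma runs_seq c1 c2 s T1 T2 Q P :
  runs c1 s T1 Q -> (forall s1, Q s1 -> runs c2 s1 T2 P) ->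
  runs (CSeq c1 c2) s (T1 + T2) P.
Proof.
move=> [t1 [s1 [ex1 le1 Q1]]] /(_ _ Q1) [t2 [s2 [ex2 le2 P2]]].
by exists (t1 + t2), s2; split; [apply: ExecSeq ex1 ex2|rewrite leq_add|].
Qed.

Lemma runs_if b c1 c2 s T P :
  runs (if Defs.tval s b then c1 else c2) s T P -> runs (CIf b c1 c2) s (tcost b + T).+1 P.
Proof.
move=> [t [s' [ex le Ps']]]; exists (tcost b + t).+1, s'; split => //.
  exact: ExecIf.
by rewrite ltnS leq_add2l.
Qed.

(** Array numbers are part of the program text, so the arrays that a program may change can be read
    off from it. This gives frame conditions without an analysis of the execution. *)
Fixpoint nwrites c : seq nat :=
  match c with
  | CSkip | CSetR _ _ _ _ => [::]
  | CSetN a _ _ _ | CAsk _ _ _ a _ _ => [:: a]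
  | CSeq c1 c2 | CIf _ c1 c2 => nwrites c1 ++ nwrites c2
  | CWhile _ c1 => nwrites c1
  end.

Fixpoint rwrites c : seq nat :=
  match c with
  | CSkip | CSetN _ _ _ _ | CAsk _ _ _ _ _ _ => [::]
  | CSetR a _ _ _ => [:: a]
  | CSeq c1 c2 | CIf _ c1 c2 => rwrites c1 ++ rwrites c2
  | CWhile _ c1 => rwrites c1
  end.

Definition agree (X Y : seq nat) s s' : Prop :=
  (forall a i j, a \notin X -> nmem s' a i j = nmem s a i j) /\
  (forall a i j, a \notin Y -> rmem s' a i j = rmem s a i j).

Lemma agree_trans X Y s1 s2 s3 : agree X Y s1 s2 -> agree X Y s2 s3 -> agree X Y s1 s3.
Proof. by move=> [a b] [c d]; split => x i j H; [rewrite c ?a|rewrite d ?b]. Qed.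

Lemma agree_sub X Y X' Y' s s' :
  {subset X <= X'} -> {subset Y <= Y'} -> agree X Y s s' -> agree X' Y' s s'.
Proof.
move=> sX sY [a b]; split => x i j H; [apply: a|apply: b]; apply: contra H.
  exact: sX.
exact: sY.
Qed.

Lemma agree_setN X Y s0 s a i j v :
  a \in X -> agree X Y s0 s -> agree X Y s0 (set_nmem s a i j v).
Proof.
move=> aX [H1 H2]; split => // a' i' j' H; rewrite /= /upd -(H1 _ _ _ H).
by case: eqP => // E; rewrite E aX in H.
Qed.

Lemma agree_setR X Y s0 s a i j v :
  a \in Y -> agree X Y s0 s -> agree X Y s0 (set_rmem s a i j v).
Proof.
move=> aX [H1 H2]; split => // a' i' j' H; rewrite /= /upd -(H2 _ _ _ H).
by case: eqP => // E; rewrite E aX in H.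
Qed.

Lemma row_set_agree X Y s s' a i :
  agree X Y s s' -> a \notin X -> row_set n s' a i = row_set n s a i.
Proof. by move=> [H _] aX; apply/setP => j; rewrite !inE H. Qed.

Lemma row_set_setN s a i b i' j v :
  a != b -> row_set n (set_nmem s b i' j v) a i = row_set n s a i.
Proof. by move=> ab; apply/setP => k; rewrite !inE /= /upd (negbTE ab). Qed.

Lemma exec_agree c s t s' :
  exec oracle c s t s' -> agree (nwrites c) (rwrites c) s s'.
Proof.
elim=> {c s t s'} //=.
- by move=> *; apply: agree_setN; rewrite ?inE.
- by move=> *; apply: agree_setR; rewrite ?inE.
- by move=> *; apply: agree_setN; rewrite ?inE.
- move=> c1 c2 s t1 s1 t2 s2 _ H1 _ H2; apply: agree_trans (agree_sub _ _ H1) (agree_sub _ _ H2);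
    by move=> x xX; rewrite mem_cat xX ?orbT.
- move=> b c1 c2 s t s' _; case: (Defs.tval s b); apply: agree_sub;
    by move=> x xX; rewrite mem_cat xX ?orbT.
- by move=> b c s t1 s1 t2 s2 _ _ H1 _ H2; apply: agree_trans H1 H2.
Qed.

Lemma runs_agree c s T P :
  runs c s T P -> runs c s T (fun s' => P s' /\ agree (nwrites c) (rwrites c) s s').
Proof.
by move=> [t [s' [ex le Ps']]]; exists t, s'; split => //; split => //; apply: exec_agree ex.
Qed.

Definition ncell (a : nat) : nexp := NGet a (NConst 0) (NConst 0).
Definition nrow (a : nat) (e : nexp) : nexp := NGet a (NConst 0) e.
Definition rcell (a : nat) : rexp := RGet a (NConst 0) (NConst 0).

Definition cfor (i : nat) (e : nexp) (body : com) : com :=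
  CSeq (CSetN i (NConst 0) (NConst 0) (NConst 0))
    (CWhile (TNot (TNatLe e (ncell i)))
      (CSeq body (CSetN i (NConst 0) (NConst 0) (NAdd (ncell i) (NConst 1))))).

(** The bound [e] is evaluated anew in every round, so the invariant must fix its value; it must
    also survive changes of the counter, which are made outside the body. Each round adds 14 steps
    to those of [body] and [e]: 5 for the rest of the test, 8 for the increment and 1 for the
    loop. *)
Lemma runs_for i e body m T s (Inv : nat -> state R -> Prop) :
  (forall k s, Inv k s -> nval s e = m) ->
  (forall k s v, Inv k s -> Inv k (set_nmem s i 0 0 v)) ->
  i \notin nwrites body ->
  (forall k s, k < m -> Inv k s -> nmem s i 0 0 = k -> runs body s T (Inv k.+1)) ->
  Inv 0 s -> runs (cfor i e body) s (m.+1 * (T + ncost e + 14)) (Inv m).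
Proof.
move=> eE st ib bodyP I0.
rewrite /cfor; set w := CWhile _ _.
have loop d k s' : k + d = m -> Inv k s' -> nmem s' i 0 0 = k ->
    runs w s' (d * (T + ncost e + 14) + (ncost e + 6)) (Inv m).
  elim: d k s' => [|d IH] k s' kd Ik ik.
    rewrite addn0 in kd; exists (tcost (TNot (TNatLe e (ncell i)))).+1, s'; split.
    - by apply: ExecWhileF; rewrite /= negbK (eE _ _ Ik) ik kd.
    - by rewrite /=; lia.
    - by rewrite -kd.
  have km : k < m by lia.
  have [t1 [s1 [ex1 le1 [I1 ag1]]]] := runs_agree (bodyP _ _ km Ik ik).
  pose s2 := set_nmem s1 i 0 0 k.+1.
  have i1 : nmem s1 i 0 0 = k by rewrite ag1.1.
  have [|||t2 [s3 [ex3 le3 I3]]] := IH k.+1 s2.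
  - by lia.
  - exact: st.
  - by rewrite /= /upd eqxx.
  exists (tcost (TNot (TNatLe e (ncell i))) + (t1 + 8) + t2).+1, s3; split => //.
  - apply: ExecWhileT ex3; first by rewrite /= (eE _ _ Ik) ik -ltnNge.
    apply: ExecSeq ex1 _; rewrite /s2.
    have -> : k.+1 = nval s1 (NAdd (ncell i) (NConst 1)) by rewrite /= i1 addn1.
    exact: ExecSetN.
  - by rewrite /=; lia.
pose s1 := set_nmem s i 0 0 0.
have [|||t [s2 [ex2 le2 I2]]] := loop m 0 s1.
- by [].
- exact: st.
- by rewrite /= /upd eqxx.
exists (4 + t), s2; split => //.
  by apply: ExecSeq ex2; apply: ExecSetN.
by rewrite mulSn; lia.
Qed.

(** * Running times as powers of [N] *)

Variable N : nat.
Hypotheses (N2 : 2 <= N) (nN : n <= N).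

Lemma const_le_pow x a : x <= 2 ^ a -> x <= N ^ a.
Proof. by move=> xa; apply: leq_trans xa _; case: a => // a; rewrite leq_exp2r. Qed.

Lemma leq_pow x a b : x <= N ^ a -> a <= b -> x <= N ^ b.
Proof. by move=> xa ab; apply: leq_trans xa _; apply: leq_pexp2l => //; apply: ltnW. Qed.

Lemma add_le_pow (x y a b c : nat) :
  x <= N ^ a -> y <= N ^ b -> a < c -> b < c -> x + y <= N ^ c.
Proof.
case: c => // c xa yb; rewrite !ltnS => ac bc; rewrite expnS.
apply: (@leq_trans (2 * N ^ c)); last by rewrite leq_mul2r N2 orbT.
by rewrite mul2n -addnn leq_add // (leq_pow xa, leq_pow yb).
Qed.

Lemma mul_le_pow x y a b : x <= N ^ a -> y <= N ^ b -> x * y <= N ^ (a + b).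
Proof. by move=> xa yb; rewrite expnD leq_mul. Qed.

(** Two of the three extra exponents pay for the [m.+1 <= n + 2] rounds, the third for the overhead,
    which is at most [18 + 14 = 2 ^ 5]. *)
Lemma runs_for_pow i e body m a s (Inv : nat -> state R -> Prop) :
  m <= n.+1 -> 5 <= a -> ncost e <= 18 ->
  (forall k s, Inv k s -> nval s e = m) ->
  (forall k s v, Inv k s -> Inv k (set_nmem s i 0 0 v)) ->
  i \notin nwrites body ->
  (forall k s, k < m -> Inv k s -> nmem s i 0 0 = k -> runs body s (N ^ a) (Inv k.+1)) ->
  Inv 0 s -> runs (cfor i e body) s (N ^ (a + 3)) (Inv m).
Proof.
move=> mn a5 ce eE st ib bodyP I0.
apply: runs_weaken (runs_for eE st ib bodyP I0) _ (fun _ H => H).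
have -> : a + 3 = 2 + a.+1 by lia.
apply: mul_le_pow; first by rewrite expnS expn1; nia.
rewrite -addnA; apply: (@add_le_pow _ _ a 5) => //.
by apply: const_le_pow; lia.
Qed.

(** * Programs for computing and comparing scores *)

Definition is_zero (a i : nat) : test := TNatLe (nrow a (ncell i)) (NConst 0).

Definition add_weight (c d : nat) : com :=
  CSetR d (NConst 0) (NConst 0)
    (RAdd (rcell d) (RMul (RNat (NConst c)) (RGet 0 (ncell 6) (ncell 7)))).

Definition score_body (c1 c2 a d : nat) : com :=
  CIf (is_zero a 6) (CIf (is_zero a 7) CSkip (add_weight c1 d))
    (CIf (is_zero a 7) (add_weight c1 d) (add_weight c2 d)).

(** Natural number arrays 6 and 7 are the inner loop counters; 8 is kept for the rounds of the
    search and 9 onwards for its nested loops. Real arrays 1 and 2 hold the scores to be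
    compared. *)
Definition score_com (c1 c2 a d : nat) : com :=
  CSeq (CSetR d (NConst 0) (NConst 0) (RNat (NConst 0)))
    (cfor 6 (ncell 0) (cfor 7 (ncell 0) (score_body c1 c2 a d))).

Lemma runs_add_weight (c d : nat) s :
  runs (add_weight c d) s 17 (fun s' => rmem s' d 0 0 =
    (rmem s d 0 0 + rmem s 0 (nmem s 6 0 0) (nmem s 7 0 0) * c%:R)%R).
Proof. by apply: runs_setR; rewrite /= /upd !eqxx mulrC. Qed.

Lemma runs_score_body (c1 c2 a d : nat) s :
  runs (score_body c1 c2 a d) s 33 (fun s' => rmem s' d 0 0 =
    (rmem s d 0 0 + rmem s 0 (nmem s 6 0 0) (nmem s 7 0 0) *
      (pair_value c1 c2 (nmem s a 0 (nmem s 6 0 0) != 0)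
        (nmem s a 0 (nmem s 7 0 0) != 0))%:R)%R).
Proof.
have -> : 33 = (tcost (is_zero a 6) + (tcost (is_zero a 7) + 17).+1).+1 by [].
apply: runs_if; rewrite /= leqn0; case: eqP => _ /=.
  apply: runs_if; rewrite /= leqn0; case: eqP => _ /=; last exact: runs_add_weight.
  by apply: runs_weaken (runs_skip (P := eq s) _) _ _ => // _ <-; rewrite /= mulr0 addr0.
by apply: runs_if; rewrite /= leqn0; case: eqP => _ /=; exact: runs_add_weight.
Qed.

Lemma runs_score (c1 c2 a d : nat) s :
  nmem s 0 0 0 = n -> a \notin [:: 6; 7] -> d != 0 ->
  runs (score_com c1 c2 a d) s (N ^ 13)
    (fun s' => rmem s' d 0 0 = score (rmem s 0) c1 c2 (row_set n s a 0) /\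
      agree [:: 6; 7] [:: d] s s').
Proof.
move=> sn a67 d0.
pose f j := nmem s a 0 j != 0.
pose F i j := (rmem s 0 i j * (pair_value c1 c2 (f i) (f j))%:R)%R.
pose ag := agree [:: 6; 7] [:: d] s.
have agn s1 : ag s1 -> nmem s1 0 0 0 = n by move=> [-> //].
apply: (@runs_weaken _ _ (5 + N ^ (6 + 3 + 3)) _
  (fun s' => ag s' /\ rmem s' d 0 0 = (\sum_(0 <= i < n) \sum_(0 <= j < n) F i j)%R)); last 2 first.
- by apply: (@add_le_pow _ _ 3 12) => //; apply: const_le_pow.
- move=> s' [? ->]; split => //; rewrite big_mkord; apply: eq_bigr => i _.
  by rewrite big_mkord; apply: eq_bigr => j _; rewrite !inE.
apply: (runs_seq (Q := fun s1 => ag s1 /\ rmem s1 d 0 0 = 0%R)).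
  apply: runs_setR; split; last by rewrite /= /upd !eqxx.
  by apply: agree_setR; rewrite ?inE.
move=> s0 [ags0 d00].
apply: (runs_for_pow (Inv := fun k s1 =>
  ag s1 /\ rmem s1 d 0 0 = (\sum_(0 <= i < k) \sum_(0 <= j < n) F i j)%R)) => //.
- by move=> k s1 [/agn].
- by move=> k s1 v [H ?]; split => //; apply: agree_setN.
- move=> i s1 _ [ag1 d1] i1.
  apply: (@runs_weaken _ _ (N ^ (6 + 3)) _ (fun s2 => ag s2 /\ nmem s2 6 0 0 = i /\
     rmem s2 d 0 0 = (\sum_(0 <= i < i) \sum_(0 <= j < n) F i j + \sum_(0 <= j < n) F i j)%R)) => //; last first.
    by move=> s2 [? [_ ?]]; split => //; rewrite big_nat_recr.
  apply: (runs_for_pow (Inv := fun k s2 => ag s2 /\ nmem s2 6 0 0 = i /\ rmem s2 d 0 0 =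
     (\sum_(0 <= i < i) \sum_(0 <= j < n) F i j + \sum_(0 <= j < k) F i j)%R)) => //.
  - by move=> k s2 [/agn].
  - by move=> k s2 v [H ?]; split => //; apply: agree_setN.
  - move=> j s2 _ [ag2 [i2 d2]] j2.
    apply: runs_weaken (runs_agree (runs_score_body c1 c2 a d s2)) _ _.
      exact: const_le_pow.
    move=> s3 [d3 ag3]; split; last split.
    + by apply: agree_trans ag2 (agree_sub _ _ ag3) => x //=; rewrite !inE !orbb.
    + by rewrite ag3.1.
    rewrite d3 d2 i2 j2 big_nat_recr //= addrA; congr (_ + _)%R.
    have w2 : rmem s2 0 i j = rmem s 0 i j by rewrite ag2.2 // inE eq_sym.
    by rewrite /F /f w2 !ag2.1.
  by split => //; split => //; rewrite d1 [in RHS]big_nil addr0.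
by split => //; rewrite d00 big_nil.
Qed.

Definition copy_com (a b : nat) : com :=
  cfor 6 (ncell 0) (CSetN b (NConst 0) (ncell 6) (nrow a (ncell 6))).

Lemma runs_copy a b s :
  nmem s 0 0 0 = n -> a != b -> a != 6 -> b != 6 -> b != 0 ->
  runs (copy_com a b) s (N ^ 8) (fun s' =>
    row_set n s' b 0 = row_set n s a 0 /\ agree [:: 6; b] [::] s s').
Proof.
move=> sn ab a6 b6 b0; pose ag := agree [:: 6; b] [::] s.
apply: (@runs_weaken _ _ (N ^ (5 + 3)) _
  (fun s' => ag s' /\ forall j, j < n -> nmem s' b 0 j = nmem s a 0 j)) => //; last first.
  by move=> s' [? H]; split => //; apply/setP => j; rewrite !inE H.
apply: (runs_for_pow (Inv := fun k s1 => ag s1 /\ forall j, j < k -> nmem s1 b 0 j = nmem s a 0 j)) => //.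
- by move=> k s1 [H _]; rewrite /= H.1 // !inE /= eq_sym.
- move=> k s1 v [H1 H2]; split; first by apply: agree_setN; rewrite ?inE ?eqxx.
  by move=> j jk; rewrite /= /upd (negbTE b6) /= H2.
- by rewrite inE eq_sym.
- move=> k s1 _ [H1 H2] k1.
  apply: (@runs_weaken _ _ 10 _ (fun s' => ag s' /\ forall j, j < k.+1 ->
    nmem s' b 0 j = nmem s a 0 j)) => //; last exact: const_le_pow.
  apply: runs_setN.
  split; first by apply: agree_setN; rewrite ?inE ?eqxx ?orbT.
  move=> j; rewrite ltnS leq_eqVlt /= k1 /upd eqxx /=; case: eqP => [->|_] /=; last exact: H2.
  by rewrite H1.1 // !inE negb_or a6.
Qed.

Definition improve_com (c1 c2 a b : nat) : com :=
  CSeq (score_com c1 c2 a 1) (CSeq (score_com c1 c2 b 2)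
    (CIf (TRealLe (rcell 1) (rcell 2)) CSkip (copy_com a b))).

Lemma runs_improve (c1 c2 a b : nat) s :
  let val x := score (rmem s 0) c1 c2 (row_set n s x 0) in
  nmem s 0 0 0 = n -> a \notin [:: 6; 7] -> b \notin [:: 6; 7] -> a != b -> b != 0 ->
  runs (improve_com c1 c2 a b) s (N ^ 15)
    (fun s' => row_set n s' b 0 = row_set n s (if (val a <= val b)%R then b else a) 0
      /\ agree [:: 6; 7; b] [:: 1; 2] s s').
Proof.
move=> val sn aX bX ab b0.
have a6 : a != 6 by apply: contraNneq aX => ->.
have b6 : b != 6 by apply: contraNneq bX => ->.
pose T3 := (tcost (TRealLe (rcell 1) (rcell 2)) + N ^ 8).+1.
apply: (@runs_weaken _ _ (N ^ 13 + (N ^ 13 + T3))) => [||s' Ps']; last 2 first.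
- apply: (@add_le_pow _ _ 13 14) => //; apply: (@add_le_pow _ _ 13 9) => //.
  by rewrite /T3 -addSn; apply: (@add_le_pow _ _ 3 8) => //; apply: const_le_pow.
- exact: Ps'.
apply: runs_seq (runs_score c1 c2 sn aX _) _ => // s1 [d1 ag1].
have n1 : nmem s1 0 0 0 = n by rewrite ag1.1.
apply: runs_seq (runs_score c1 c2 n1 bX _) _ => // s2 [d2 ag2].
have row x : x \notin [:: 6; 7] -> row_set n s2 x 0 = row_set n s x 0.
  by move=> xX; rewrite (row_set_agree 0 ag2 xX) (row_set_agree 0 ag1 xX).
rewrite /T3; apply: runs_if; rewrite [Defs.tval _ _]/=.
have -> : rmem s2 1 0 0 = val a by rewrite ag2.2 // d1.
have -> : rmem s2 2 0 0 = val b.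
  rewrite d2 /val (row_set_agree 0 ag1 bX).
  rewrite /score; apply: eq_bigr => i _; apply: eq_bigr => j _.
  by rewrite ag1.2.
have ag s' : agree [:: 6; b] [::] s2 s' -> agree [:: 6; 7; b] [:: 1; 2] s s'.
  move=> ag3; apply: agree_trans (agree_sub _ _ ag1) _.
  - by move=> x; rewrite !inE => /orP[]->; rewrite ?orbT.
  - by move=> x; rewrite !inE => ->.
  apply: agree_trans (agree_sub _ _ ag2) (agree_sub _ _ ag3) => // x.
  - by rewrite !inE => /orP[]->; rewrite ?orbT.
  - by rewrite !inE orbC => ->.
  - by rewrite !inE => /orP[]->; rewrite ?orbT.
case: ifP => _.
  apply: (@runs_weaken _ _ 1 _ (eq s2)); first exact: runs_skip.
    exact: (@const_le_pow 1 8).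
  by move=> _ <-; rewrite row //; split => //; apply: ag.
have n2 : nmem s2 0 0 0 = n by rewrite ag2.1.
apply: runs_weaken (runs_copy n2 ab a6 b6 b0) _ _ => // s' [-> ag3].
by rewrite row //; split => //; apply: ag.
Qed.

(** * The local search *)

Definition row s (a : nat) : {set 'I_n} := row_set n s a 0.

Definition feasible (X : {set 'I_n}) : bool := oracle false X && oracle true X.

Variable w : nat -> nat -> R.

(* Row 1 is the output, row 3 the set under examination and row 4 the best
   neighbour found so far. *)
Definition search_state s : Prop :=
  [/\ nmem s 0 0 0 = n, forall i j, rmem s 0 i j = w i j,
      feasible (row s 4) & feasible (row s 1)].

(** Row 4 is judged by the potential, which drives the search, row 1 by the coverage, which the
    guarantee is about. A set that is best for one need not be best for the other. *)
Definition dominates s (U : {set 'I_n}) : Prop :=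
  (score w 2 3 U <= score w 2 3 (row s 4))%R /\ (score w 1 1 U <= score w 1 1 (row s 1))%R.

Definition progress s s' : Prop :=
  (score w 2 3 (row s 4) <= score w 2 3 (row s' 4))%R /\
  (score w 1 1 (row s 1) <= score w 1 1 (row s' 1))%R.

Lemma progress_dominates s s' U : progress s s' -> dominates s U -> dominates s' U.
Proof. by move=> [p1 p2] [/le_trans/(_ p1) ? /le_trans/(_ p2) ?]. Qed.

Lemma search_state_agree X Y s s' :
  agree X Y s s' -> [&& 0 \notin X, 1 \notin X, 4 \notin X & 0 \notin Y] ->
  search_state s -> search_state s' /\ progress s s'.
Proof.
move=> ag /and4P[X0 X1 X4 Y0] [sn sw s4 s1].
have r1 : row s' 1 = row s 1 by apply: row_set_agree ag X1.
have r4 : row s' 4 = row s 4 by apply: row_set_agree ag X4.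
split; last by rewrite /progress r1 r4.
split; rewrite ?r1 ?r4 //; first by rewrite ag.1.
by move=> i j; rewrite ag.2.
Qed.

Lemma progress_trans s1 s2 s3 : progress s1 s2 -> progress s2 s3 -> progress s1 s3.
Proof. by move=> [/le_trans H1 /le_trans H2] [/H1 ? /H2 ?]. Qed.

Definition visit_com : com :=
  CSeq (CAsk false 3 (NConst 0) 5 (NConst 0) (NConst 0))
  (CSeq (CAsk true 3 (NConst 0) 5 (NConst 0) (NConst 1))
    (CIf (TAnd (TNot (TNatLe (ncell 5) (NConst 0)))
               (TNot (TNatLe (nrow 5 (NConst 1)) (NConst 0))))
      (CSeq (improve_com 2 3 3 4) (improve_com 1 1 3 1)) CSkip)).

Lemma eq_score (w1 w2 : nat -> nat -> R) (c1 c2 : nat) (X : {set 'I_n}) :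
  (forall i j, w1 i j = w2 i j) -> score w1 c1 c2 X = score w2 c1 c2 X.
Proof. by move=> H; apply: eq_bigr => i _; apply: eq_bigr => j _; rewrite H. Qed.

Lemma runs_visit s : search_state s ->
  runs visit_com s (N ^ 18) (fun s' => [/\ search_state s', row s' 3 = row s 3,
    progress s s' & feasible (row s 3) -> dominates s' (row s 3)]).
Proof.
move=> oks.
pose T3 := (13 + (N ^ 15 + N ^ 15)).+1.
apply: (@runs_weaken _ _ (4 + (4 + T3)) _ _ _ _ _ (fun _ H => H)); last first.
  have -> : 4 + (4 + T3) = 22 + (N ^ 15 + N ^ 15) by rewrite /T3; lia.
  apply: (@add_le_pow _ _ 5 16) => //; first exact: const_le_pow.
  exact: (@add_le_pow _ _ 15 15).
pose s1 := set_nmem s 5 0 0 (oracle false (row s 3)).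
pose s2 := set_nmem s1 5 0 1 (oracle true (row s1 3)).
apply: (runs_seq (Q := eq s1)); first exact: runs_ask.
move=> _ <-; apply: (runs_seq (Q := eq s2)); first exact: runs_ask.
move=> _ <-.
have ag2 : agree [:: 5] [::] s s2 by do 2 apply: agree_setN => //.
have r x : x != 5 -> row s2 x = row s x.
  by move=> x5; rewrite /row !row_set_setN.
have [ok2 pr2] : search_state s2 /\ progress s s2 by apply: search_state_agree ag2 _ oks.
rewrite /T3.
have -> : 13 = tcost (TAnd (TNot (TNatLe (ncell 5) (NConst 0)))
               (TNot (TNatLe (nrow 5 (NConst 1)) (NConst 0)))) by [].
apply: runs_if.
have -> : Defs.tval s2 (TAnd (TNot (TNatLe (ncell 5) (NConst 0)))
    (TNot (TNatLe (nrow 5 (NConst 1)) (NConst 0)))) = feasible (row s 3).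
  have -> : row s 3 = row s1 3 by rewrite /row row_set_setN.
  rewrite /= /upd /= /feasible -!ltnNge !lt0b.
  by congr (_ && _); rewrite /row row_set_setN.
case: (boolP (feasible (row s 3))) => fT; last first.
  apply: (@runs_weaken _ _ 1 _ (eq s2)); first exact: runs_skip.
    by rewrite (leq_trans _ (leq_addr _ _)) // expn_gt0; lia.
  by move=> _ <-; split; rewrite ?r.
have [n2 w2 f4 f1] := ok2.
apply: (@runs_weaken _ _ (N ^ 15 + N ^ 15) _ _ _ _ (leqnn _) (fun _ H => H)).
have i1 := runs_improve 2 3 n2 (a := 3) (b := 4) isT isT isT isT.
apply: (runs_seq i1) => s3 [r4 ag3].
have n3 : nmem s3 0 0 0 = n by rewrite ag3.1.
apply: runs_weaken (runs_improve 1 1 n3 (a := 3) (b := 1) isT isT isT isT) (leqnn _) _.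
move=> s4 [r1 ag4].
have w3 i j : rmem s3 0 i j = w i j by rewrite ag3.2.
have r34 : row s4 4 = row s3 4 by apply: row_set_agree ag4 _.
have r33 : row s3 3 = row s 3 by rewrite -r //; apply: row_set_agree ag3 _.
have r31 : row s3 1 = row s 1 by rewrite -r //; apply: row_set_agree ag3 _.
rewrite !(eq_score _ _ _ w2) -!/(row s2 _) -/(row s3 _) (r 3) // (r 4) // in r4.
rewrite !(eq_score _ _ _ w3) -!/(row s3 _) -/(row s4 _) r33 r31 in r1.
rewrite -!/(row s2 _) in f4 f1; rewrite r // in f4; rewrite r // in f1.
have row4 : row s4 4 = if (score w 2 3 (row s 3) <= score w 2 3 (row s 4))%R then row s 4 else row s 3.
  by rewrite r34 r4; case: ifP => _; rewrite r.
have row1 : row s4 1 = if (score w 1 1 (row s 3) <= score w 1 1 (row s 1))%R then row s 1 else row s 3.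
  by rewrite r1; case: ifP => _; rewrite ?r31 ?r33.
have best4 : (score w 2 3 (row s 3) <= score w 2 3 (row s4 4))%R /\
    (score w 2 3 (row s 4) <= score w 2 3 (row s4 4))%R.
  by rewrite row4; case: (leP (score w 2 3 (row s 3)) (score w 2 3 (row s 4))) => [?|/ltW ?]; split.
have best1 : (score w 1 1 (row s 3) <= score w 1 1 (row s4 1))%R /\
    (score w 1 1 (row s 1) <= score w 1 1 (row s4 1))%R.
  by rewrite row1; case: (leP (score w 1 1 (row s 3)) (score w 1 1 (row s 1))) => [?|/ltW ?]; split.
split.
- split; first by rewrite ag4.1.
  + by move=> i j; rewrite ag4.2.
  + by rewrite row4; case: ifP.
  + by rewrite row1; case: ifP.
- by rewrite -r33; apply: row_set_agree ag4 _.
- by split; [case: best4 | case: best1].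
- by move=> _; split; [case: best4 | case: best1].
Qed.

Definition toggle_com (i : nat) : com :=
  CSetN 3 (NConst 0) (ncell i) (NSub (NConst 1) (nrow 3 (ncell i))).

Definition toggle (T : {set 'I_n}) (u : nat) : {set 'I_n} :=
  [set j | (j \in T) (+) (nat_of_ord j == u)].

Lemma runs_toggle i s :
  runs (toggle_com i) s 12 (fun s' => row s' 3 = toggle (row s 3) (nmem s i 0 0) /\
    agree [:: 3] [::] s s').
Proof.
apply: runs_setN; split; last exact: agree_setN.
apply/setP => j; rewrite !inE /= /upd /=.
have [<-|_] := eqVneq (nat_of_ord j) (nmem s i 0 0); last by rewrite addbF.
by case: (nmem s 3 0 j).
Qed.

(** Each of the [k] nested loops toggles one index from [0] to [n] and undoes it afterwards. Index
    [n] is no vertex and changes nothing, so sets at distance less than [k] are reached as well.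
    Intermediate sets may be infeasible; [visit_com] ignores them. *)
Fixpoint nest_com (k : nat) : com :=
  if k is k'.+1 then
    cfor (9 + k') (NAdd (ncell 0) (NConst 1))
      (CSeq (toggle_com (9 + k')) (CSeq (nest_com k') (toggle_com (9 + k'))))
  else visit_com.

(** Protects the counters of the loops around [nest_com k]: array 8 and the arrays from [9 + k]
    on. *)
Lemma nwrites_nest i k : (i == 8) || (9 + k <= i) -> i \notin nwrites (nest_com k).
Proof.
clear nN N2; elim: k => [|k IH] ik; first by rewrite /= !inE; lia.
have iN : (i \in nwrites (nest_com k)) = false by apply/negbTE/IH; lia.
by rewrite [nest_com _]/= /cfor /= !(inE, mem_cat) iN; lia.
Qed.

Definition symdiff (T U : {set 'I_n}) : {set 'I_n} := (T :\: U) :|: (U :\: T).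

Lemma symdiff_toggle (T U : {set 'I_n}) k :
  #|symdiff T U| <= k.+1 -> exists2 u, u < n.+1 & #|symdiff (toggle T u) U| <= k.
Proof.
move=> TU; have [D0|/set0Pn[x xD]] := eqVneq (symdiff T U) set0.
  exists n => //; suff -> : toggle T n = T by rewrite D0 cards0.
  by apply/setP => j; rewrite !inE (ltn_eqF (ltn_ord j)) addbF.
exists x; first by rewrite ltnS ltnW.
rewrite -ltnS; apply: leq_trans TU.
rewrite [X in _ < X](cardsD1 x) xD add1n ltnS; apply: subset_leq_card.
apply/subsetP => j; rewrite !inE; have [->|jx] := eqVneq j x.
  by move: xD; rewrite !inE eqxx; case: (x \in T); case: (x \in U).
by rewrite -val_eqE /= in jx; rewrite (negbTE jx) addbF.
Qed.

Lemma toggleK T u : toggle (toggle T u) u = T.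
Proof. by apply/setP => j; rewrite !inE -addbA addbb addbF. Qed.

Lemma runs_nest k s : search_state s ->
  runs (nest_com k) s (N ^ (18 + 5 * k)) (fun s' => [/\ search_state s',
    row s' 3 = row s 3, progress s s' &
    forall U, feasible U -> #|symdiff (row s 3) U| <= k -> dominates s' U]).
Proof.
elim: k s => [|k IH] s oks.
  apply: runs_weaken (runs_visit oks) (leqnn _) _ => s' [ok' r3 pr dom]; split => // U fU.
  rewrite leqn0 cards_eq0 setU_eq0 !setD_eq0 -eqEsubset => /eqP E.
  by rewrite -E; apply: dom; rewrite E.
pose c := 9 + k; pose T := row s 3.
pose Inv m s1 := [/\ search_state s1, row s1 3 = T, progress s s1 &
  forall u U, u < m -> feasible U -> #|symdiff (toggle T u) U| <= k -> dominates s1 U].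
apply: (@runs_weaken _ _ (N ^ (18 + 5 * k + 1 + 3)) _ (Inv n.+1)); last 2 first.
- by apply: leq_pow (leqnn _) _; lia.
- move=> s' [ok' r3 pr dom]; split => // U fU /symdiff_toggle[u un dU].
  exact: dom un fU dU.
rewrite [nest_com _]/= -/(nest_com k); apply: runs_for_pow => //.
- by move=> m s1 [[n1 _ _ _] _ _ _]; rewrite /= n1 addn1.
- have cN : (c \in nwrites (nest_com k)) = false by apply/negbTE/nwrites_nest; rewrite leqnn orbT.
  by rewrite /= !(inE, mem_cat) -/(nest_com k) cN /c; lia.
- move=> u s1 _ [ok1 r3 pr1 dom1] cu.
  apply: (@runs_weaken _ _ (12 + (N ^ (18 + 5 * k) + 12)) _ (Inv u.+1)) => //; last first.
    rewrite addnCA addnC; apply: (@add_le_pow _ _ 5 (18 + 5 * k)) => //; try lia.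
  apply: (runs_seq (runs_toggle c s1)) => s2 [r32 ag2].
  have [|ok2 pr2] := search_state_agree ag2 _ ok1; first by [].
  have c2 : nmem s2 c 0 0 = u by rewrite ag2.1 ?cu // inE /c; lia.
  apply: (runs_seq (runs_agree (IH s2 ok2))) => s3 [[ok3 r33 pr3 dom3] ag3].
  have c3 : nmem s3 c 0 0 = u by rewrite ag3.1 // nwrites_nest // leqnn orbT.
  apply: runs_weaken (runs_toggle c s3) (leqnn _) _ => s4 [r34 ag4].
  have [|ok4 pr4] := search_state_agree ag4 _ ok3; first by [].
  rewrite cu r3 in r32; rewrite c3 r33 r32 toggleK in r34.
  have pr14 := progress_trans pr2 (progress_trans pr3 pr4).
  split => //; first exact: progress_trans pr1 pr14.
  move=> v U; rewrite ltnS leq_eqVlt => /orP[/eqP->|vu] fU dU.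
    by apply: progress_dominates pr4 _; apply: dom3 => //; rewrite r32.
  by apply: progress_dominates pr14 _; apply: dom1 vu fU dU.
Qed.

End ProgramLogic.

Fixpoint ntimes (k : nat) (e : nexp) : nexp :=
  if k is k'.+1 then NAdd e (ntimes k' e) else NConst 0.

(* With 3 (p + 1) (n + 1) rounds the total gain, spread over the rounds, fits into
   the slack between 2p / (2p + 1) and p / (p + 1). *)
Definition search_com (p : nat) : com :=
  cfor 8 (ntimes (3 * p.+1) (NAdd (ncell 0) (NConst 1)))
    (CSeq (copy_com 4 3) (nest_com (2 * (2 * p)).+1)).

Lemma nval_ntimes (R : realFieldType) (s : state R) k e : nval s (ntimes k e) = (k * nval s e)%N.
Proof. by elim: k => //= k ->; rewrite mulSn. Qed.

Lemma ncost_ntimes k e : ncost (ntimes k e) = (k * (ncost e).+1).+1.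
Proof. by elim: k => //= k ->; rewrite mulSn; lia. Qed.

(** Factors depending on [p] are absorbed by [p.+1 <= N ^ p], which keeps the constant in the
    exponent independent of [p]. The exponents add up to [21 * p + 36], at most [60 * p] for
    positive [p]. *)
Lemma search_time (n p : nat) : (0 < p)%N ->
  ((3 * p.+1 * n.+1).+1 *
    (maxn 2 n ^ 8 + maxn 2 n ^ (18 + 5 * (2 * (2 * p)).+1) +
      ncost (ntimes (3 * p.+1) (NAdd (ncell 0) (NConst 1))) + 14) <=
   maxn 2 n ^ (60 * p))%N.
Proof.
move=> p0; set N := maxn 2 n.
have N2 : (2 <= N)%N by rewrite leq_maxl.
have nN : (n <= N)%N by rewrite leq_maxr.
have lep : (p.+1 <= N ^ p)%N.
  by apply: leq_trans (ltn_expl p (isT : 1 < 2)%N) _; rewrite leq_exp2r.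
have nN2 : (n.+1 <= N ^ 2)%N by rewrite expnS expn1; nia.
have m_le : ((3 * p.+1 * n.+1).+1 <= N ^ (p + 5))%N.
  have -> : (p + 5 = (2 + p + 2).+1)%N by lia.
  rewrite -addn1; apply: (@add_le_pow _ N2 _ _ (2 + p + 2) 0) => //.
  by do 2 apply: mul_le_pow => //; apply: const_le_pow.
have cost_le : (ncost (ntimes (3 * p.+1) (NAdd (ncell 0) (NConst 1))) + 14 <= N ^ (p + 6))%N.
  rewrite ncost_ntimes /= [(p + 6)%N]addnC.
  apply: (@leq_trans (2 ^ 6 * p.+1)%N); first by lia.
  by apply: mul_le_pow => //; apply: const_le_pow.
apply: (@leq_trans (N ^ (p + 5 + (26 + 5 * (2 * (2 * p)).+1)))%N); last first.
  by apply: leq_pexp2l; lia.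
apply: mul_le_pow => //; rewrite -addnA.
apply: (@add_le_pow _ N2 _ _ (25 + 5 * (2 * (2 * p)).+1) (p + 6)) => //; try lia.
by apply: (@add_le_pow _ N2 _ _ 8 (18 + 5 * (2 * (2 * p)).+1)) => //; lia.
Qed.

(** The inequalities of [local_gain], with [2 * p] as its parameter, are added over the rounds. The
    gains telescope to the potential of row 4, and the coverage of the set at the start of each
    round is replaced by the larger coverage of row 1. *)
Lemma runs_search (R : realFieldType) (n p : nat) (G : wgraph R n) (M1 M2 : matroid 'I_n) :
  (0 < p)%N ->
  runs (matroid_oracle M1 M2) (search_com p) (init_state G) (maxn 2 n ^ (60 * p))
    (fun s => search_state (matroid_oracle M1 M2) (weight_entry G) s /\
      forall X : {set 'I_n}, indep M1 X -> indep M2 X ->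
      let m := (3 * p.+1 * n.+1)%N in
      (m * (4 * p))%:R * score (weight_entry G) 1 1 X <=
      (m * (3 * (2 * p).+1))%:R * score (weight_entry G) 1 1 (row n s 1) +
      (2 * p * n)%:R * score (weight_entry G) 2 3 (row n s 4)).
Proof.
move=> p0; set m := (3 * p.+1 * n.+1)%N.
set w := weight_entry G; set N := maxn 2 n.
have w0 i j : 0 <= w i j by apply: weight_entry_ge0.
have N2 : (2 <= N)%N by rewrite leq_maxl.
have nN : (n <= N)%N by rewrite leq_maxr.
pose Inv k (s : state R) := search_state (matroid_oracle M1 M2) w s /\
  forall X : {set 'I_n}, indep M1 X -> indep M2 X ->
    (k * (4 * p))%:R * score w 1 1 X <=
    (k * (3 * (2 * p).+1))%:R * score w 1 1 (row n s 1) +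
    (2 * p * n)%:R * score w 2 3 (row n s 4).
apply: (runs_weaken (P := Inv m) _ (search_time n p0)) => //.
apply: runs_for.
- by move=> k s [[sn _ _ _] _]; rewrite nval_ntimes /= sn addn1.
- by [].
- have := @nwrites_nest 8 (2 * (2 * p)).+1 isT.
  by set c := nest_com _ => c8; rewrite /= in_cons c8.
- move=> k s _ [ok inv] _.
  have [sn _ f4 f1] := ok.
  apply: (runs_seq (runs_copy (matroid_oracle M1 M2) N2 nN sn (a := 4) (b := 3) isT isT isT isT)).
  move=> s1 [r31 ag1]; have [ok1 pr1] := search_state_agree ag1 isT ok.
  have r1 : row n s1 1 = row n s 1 by apply: row_set_agree ag1 _.
  have r4 : row n s1 4 = row n s 4 by apply: row_set_agree ag1 _.
  apply: runs_weaken (runs_nest N2 nN (2 * (2 * p)).+1 ok1) (leqnn _) _.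
  move=> s2 [ok2 _ [pr4 prE] dom]; split => // X X1 X2.
  rewrite -/(row n s1 3) -/(row n s 4) in r31; rewrite r31 in dom.
  rewrite r1 in prE; rewrite r4 in pr4.
  have [S1 S2] := andP f4.
  set S := row n s 4 in S1 S2 dom pr4 *.
  (* The starting set of the round is itself visited, so row 1 covers at least as much. *)
  have domS : dominates w s2 S by apply: dom; rewrite // /symdiff setDv setU0 cards0.
  have := @local_gain _ _ w M1 M2 S X (2 * p) (score w 2 3 (row n s2 4) - score w 2 3 S)
    w0 _ S1 S2 X1 X2 _.
  rewrite muln_gt0 p0 => /(_ isT) gain.
  have {}gain := gain _.
  have {gain} : (2 * (2 * p))%:R * score w 1 1 X <= (3 * (2 * p).+1)%:R * score w 1 1 S +
      (2 * p * n)%:R * (score w 2 3 (row n s2 4) - score w 2 3 S).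
    apply: gain => U U1 U2 dU; rewrite addrC subrK.
    by have [] := dom U _ dU; [rewrite /feasible /= U1 U2|].
  have := inv X X1 X2; rewrite -/S.
  have -> : (2 * (2 * p) = 4 * p)%N by lia.
  rewrite !mulSn !natrD !mulrDl.
  have c0 : 0 <= (3 * (2 * p).+1)%:R :> R by rewrite ler0n.
  have c1 : 0 <= (k * (3 * (2 * p).+1))%:R :> R by rewrite ler0n.
  have := ler_wpM2l c0 domS.2; have := ler_wpM2l c1 prE.
  lra.
- split.
    split; [by []|by []| |].
    + have r0 a : a != 0%N -> row n (init_state G) a = set0.
        by move=> a0; apply/setP => j; rewrite !inE /= /upd (negbTE a0).
      by rewrite /feasible r0 //= !indep0.
    + have r0 a : a != 0%N -> row n (init_state G) a = set0.
        by move=> a0; apply/setP => j; rewrite !inE /= /upd (negbTE a0).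
      by rewrite /feasible r0 //= !indep0.
  move=> X _ _; rewrite !mul0n !mul0r add0r mulr_ge0 ?ler0n //.
  exact: score_ge0.
Qed.

(* c is independent of p, the instance and R: the bound on the number t of steps
   is n ^ O(p), made meaningful for n < 2. *)
Theorem theorem3 :
  exists c : nat, forall p : nat, (0 < p)%N ->
  exists prog : com,
  forall (R : realFieldType) (n : nat) (G : wgraph R n) (M1 M2 : matroid 'I_n),
  exists (t : nat) (s : state R),
    [/\ exec (matroid_oracle M1 M2) prog (init_state G) t s,
        (t <= maxn 2 n ^ (c * p))%N,
        indep M1 (output n s) /\ indep M2 (output n s)
      & edge_weight G (output n s) >=
          2%:R / 3%:R * (1 - 1 / (p%:R + 1)) * max_common_weight G M1 M2].
Proof.
exists 60 => p p0; exists (search_com p) => R n G M1 M2.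
have [t [s [ex le [[_ _ f4 f1] opt]]]] := runs_search G M1 M2 p0.
exists t, s; split => //; first by apply/andP.
set w := weight_entry G in opt.
have w0 i j : 0 <= w i j by apply: weight_entry_ge0.
pose feas (X : {set 'I_n}) := indep M1 X && indep M2 X.
have feas0 : feas set0 by rewrite /feas !indep0.
pose X := [arg max_(X > set0 | feas X) edge_weight G X]%O.
have [fX maxX] : feas X /\ forall Y, feas Y -> edge_weight G Y <= edge_weight G X.
  by rewrite /X; case: arg_maxP.
have -> : max_common_weight G M1 M2 = edge_weight G X.
  apply/eqP; rewrite eq_le; apply/andP; split.
    by apply: bigmax_le => [|Y fY]; apply: maxX.
  exact: (le_bigmax_cond _ _ fX).
have [X1 X2] := andP fX.
have := opt X X1 X2; rewrite /=.
have := potential_le_coverage (row n s 4) w0.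
rewrite !edge_weight_score -/(output n s).
have := maxX _ f4.
rewrite -[row n s 1]/(output n s).
set F := score w 2 3 _; set e := edge_weight G (output n s).
set M := edge_weight G X; set e4 := edge_weight G _ => e4M Fe4.
rewrite !natrM -[p.+1%:R]natr1 -[n.+1%:R]natr1 -[(2 * p).+1%:R]natr1 !natrM.
have pR : 0 < p%:R :> R by rewrite ltr0n.
have nR : 0 <= n%:R :> R by rewrite ler0n.
have M0 : 0 <= M by apply: sumr_ge0 => E /andP[/weight_ge0].
move: (p%:R) (n%:R) pR nR => {p0 le opt ex}P n' P0 n0 main.
(* Row 4 is feasible, so its potential is at most three times its coverage score, hence at most
   [6 * M]. *)
have {main} : 3 * (P + 1) * (n' + 1) * (4 * P) * (2 * M) <=
    3 * (P + 1) * (n' + 1) * (3 * (2 * P + 1)) * (2 * e) + 2 * P * n' * (6 * M).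
  have FM : 2 * P * n' * F <= 2 * P * n' * (6 * M).
    by apply: ler_wpM2l; [rewrite !mulr_ge0 // ltW | lra].
  by move: main FM; lra.
move=> main.
have P1 : 0 < P + 1 by lra.
have key : 2 * P * M <= 3 * (P + 1) * e.
  (* After [main] is multiplied by [P + 1] and the claim by this constant, the terms in [e] agree.
     The terms in [M] differ by [12 * P * (P + 1) * M] times [(n' + 1) - n']: the factor [n' + 1] in
     the number of rounds outweighs the factor [n'] of the error. *)
  have c0 : 0 < 6 * (P + 1) * (n' + 1) * (2 * P + 1) by rewrite !mulr_gt0 //; lra.
  have PM : 0 <= P * M * (P + 1) by rewrite !mulr_ge0 // ltW.
  rewrite -(ler_pM2l c0).
  have := ler_wpM2l (ltW P1) main.
  nra.
have -> : 2%:R / 3%:R * (1 - 1 / (P + 1)) * M = 2 * P * M / (3 * (P + 1)).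
  by field; rewrite gt_eqF.
by rewrite ler_pdivrMr ?mulr_gt0 // [e * _]mulrC.
Qed.
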